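(* Let $p$ be a prime, $k\ge0$ and $m\ge1$ integers, and let $\mathcal S_1,\dots,\mathcal S_m$ be $\mathbb Z_p$-combinatorial spheres with pairwise disjoint vertex sets. Then for every $\mathbb Z_p$-equivariant simplicial map $f:\operatorname{Bd}^k(\mathcal S_1*\cdots*\mathcal S_m)\to\mathcal S_1*\cdots*\mathcal S_m$, \[\deg(f)\equiv1\pmod p,\] where $\deg$ denotes the combinatorial degree.
   Context: A simplicial complex $\mathcal K$ is a finite nonempty collection of finite sets closed under subsets (so $\emptyset\in\mathcal K$); $\dim\sigma=|\sigma|-1$; $\alpha$ is a facet of $\beta$ if $\alpha\subseteq\beta$ and $\dim\alpha=\dim\beta-1$. A total order on $V(\mathcal K)=\bigcup\mathcal K$ is fixed and a $q$-simplex with vertices $x_0<\dots<x_q$ is the oriented simplex $[x_0,\dots,x_q]$. $C_q(\mathcal K)$ is the free $\mathbb Z$-module on the $q$-simplices ($q\ge0$; $0$ otherwise). Incidence: for a $q$-simplex $\sigma=[x_0,\dots,x_q]$ and a $(q-1)$-simplex $\tau$, $[\sigma,\tau]=(-1)^i$ if $\tau=\sigma\setminus\{x_i\}$, $0$ if $\tau\not\subseteq\sigma$. Boundary: $\partial_q\sigma=\sum_\tau[\sigma,\tau]\tau$ for $q\ge1$, $\partial_0=0$. A discrete vector field $\mathcal V$ is a set of pairs $(\alpha,\beta)$ of simplices ($\alpha=\emptyset$ allowed) with $\alpha$ a facet of $\beta$, each simplex in at most one pair; a $\mathcal V$-trajectory is $\beta_0,\alpha_1,\beta_1,\dots,\alpha_r,\beta_r$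 (alternately $q$- and $(q-1)$-simplices) with $(\alpha_i,\beta_i)\in\mathcal V$, $\alpha_i\subsetneq\beta_{i-1}\neq\beta_i$; nontrivial closed if $r>0$, $\beta_r=\beta_0$. A gradient vector field has no nontrivial closed trajectory. A nonempty simplex is critical if it lies in no pair, or is a $0$-simplex $\sigma$ with $(\emptyset,\sigma)\in\mathcal V$. A $d$-dimensional pseudomanifold: all maximal simplices of dimension $d$, every $(d-1)$-simplex in exactly two $d$-simplices, any two $d$-simplices joined by a chain of $d$-simplices with consecutive ones meeting in a $(d-1)$-simplex. A combinatorial $d$-sphere is a $d$-dimensional pseudomanifold admitting a gradient vector field with exactly two critical simplices, one $d$-dimensional and one $0$-dimensional. For its $d$-simplices $\sigma_1,\dots,\sigma_n$, an orientation is $\xi\in\{\pm1\}^n$ with $\partial_d(\sum\xi_i\sigma_i)=0$; $[\mathcal S_\xi]=\sum\xi_i\sigma_i$. Join: $\mathcal K_1*\mathcal K_2=\{\sigma\sqcup\tau\}$ for disjoint vertex sets. $\operatorname{Bd}(\mathcal K)$: vertices $v_\sigma$ ($\sigma\ne\emptyset$), simplices the chains $\{v_{\sigma_0},\dots,v_{\sigma_n}\}$, $\sigma_0\subsetneq\dots\subsetneq\sigma_n$; $\operatorname{Bd}^k$ its iterate. A simplicial map $f$ induces $f_q([v_0,\dots,v_q])=[f(v_0),\dots,f(v_q)]$ (as oriented simplex) if the images are distinct and $0$ otherwise. The subdivision chain map $g:C_\#(\mathcal K)\to C_\#(\operatorname{Bd}\mathcal K)$ is $g_0(v)=v_{\{v\}}$,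 $g_q(\sigma)=v_\sigma*g_{q-1}(\partial\sigma)$ with $v*[w_0,\dots,w_{q-1}]=[v,w_0,\dots,w_{q-1}]$; $g^k$ is its $k$-fold composite $C_\#(\mathcal K)\to C_\#(\operatorname{Bd}^k\mathcal K)$. For a combinatorial $d$-sphere $\mathcal S$ and simplicial $f:\operatorname{Bd}^k(\mathcal S)\to\mathcal S$, the combinatorial degree $\deg(f)$ is the integer $m$ with $(g^k_d\circ f_d)([\operatorname{Bd}^k(\mathcal S)_\xi])=m[\operatorname{Bd}^k(\mathcal S)_\xi]$ for an orientation $\xi$ of the combinatorial sphere $\operatorname{Bd}^k(\mathcal S)$ (it exists and is independent of $\xi$). A $\mathbb Z_p$-combinatorial sphere is a combinatorial sphere with a free simplicial $\mathbb Z_p$-action (by simplicial automorphisms, no non-identity element mapping a nonempty simplex to itself). $\mathbb Z_p$ acts diagonally on joins, $g\cdot(\sigma\sqcup\tau)=g\sigma\sqcup g\tau$, and on $\operatorname{Bd}^k$ by $g\cdot v_\sigma=v_{g\sigma}$; $f$ is equivariant if $f(g\sigma)=gf(\sigma)$. *)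

(* Defs.v *)
From HB Require Import structures.
From mathcomp Require Import all_boot all_order all_algebra all_fingroup.

Set Implicit Arguments.
Unset Strict Implicit.
Unset Printing Implicit Defensive.

Import GRing.Theory.

(* A simplicial complex is a set of subsets of an ambient finite type T whose
   elements need not all be vertices; its vertex set is [cover K].  A simplex
   of dimension q is a set of cardinal q.+1, and the empty simplex is set0. *)

Section Complexes.
Variable T : finType.
Implicit Types (K L : {set {set T}}) (s t : {set T}).

Definition is_complex K : Prop :=
  K != set0 /\ (forall s t, s \in K -> t \subset s -> t \in K).

Definition simplices K (q : nat) : {set {set T}} :=
  [set s in K | #|s| == q.+1].

Definition complex_dim K : nat := (\max_(s in K) #|s|).-1.

Definition is_facet s t : bool := (s \subset t) && (#|t| == #|s|.+1).

Definition join K L : {set {set T}} := [set s :|: t | s in K, t in L].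

(* The vertex v_s of Bd(K) is represented by the nonempty simplex s itself. *)
Definition Bd K : {set {set {set T}}} :=
  [set c : {set {set T}} | (c \subset K :\ set0) &&
     [forall s in c, forall t in c, (s \subset t) || (t \subset s)]].

Definition pseudomanifold (d : nat) K : Prop :=
  [/\ forall s, s \in K ->
        (forall t, t \in K -> s \subset t -> t = s) -> #|s| = d.+1,
      forall t, t \in K -> #|t| = d ->
        #|[set s in simplices K d | t \subset s]| = 2
    & {in simplices K d &, forall s t,
        connect [rel a b | [&& a \in simplices K d, b \in simplices K d
                             & #|a :&: b| == d]] s t}].

Definition discrete_vector_field K (V : {set {set T} * {set T}}) : Prop :=
  (forall a b, (a, b) \in V -> [/\ a \in K, b \in K & is_facet a b]) /\
  (forall s, #|[set ab in V | (ab.1 == s) || (ab.2 == s)]| <= 1).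

(* [trajectory V b0 [:: (a1, b1); ...; (ar, br)]] says that
   b0, a1, b1, ..., ar, br is a V-trajectory. *)
Fixpoint trajectory (V : {set {set T} * {set T}}) (b0 : {set T})
    (w : seq ({set T} * {set T})) : bool :=
  if w is (a, b) :: w' then
    [&& (a, b) \in V, is_facet a b0, b0 != b & trajectory V b w']
  else true.

Definition gradient_vector_field K (V : {set {set T} * {set T}}) : Prop :=
  discrete_vector_field K V /\
  (forall b0 w, b0 \in K -> trajectory V b0 w ->
     (0 < size w)%N -> last b0 (unzip2 w) <> b0).

Definition critical K (V : {set {set T} * {set T}}) : {set {set T}} :=
  [set s in K | (s != set0) &&
    ([forall ab in V, (ab.1 != s) && (ab.2 != s)]
     || ((#|s| == 1) && ((set0, s) \in V)))].

Definition combinatorial_sphere (d : nat) K : Prop :=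
  [/\ is_complex K, pseudomanifold d K &
      exists V, gradient_vector_field K V /\
        exists s t, [/\ s != t, #|s| = d.+1, #|t| = 1 &
                        critical K V = [set s; t]]].

End Complexes.

Section Iterate.
Variable T : finType.

Fixpoint bdT (k : nat) : finType :=
  if k is k'.+1 then {set (bdT k')} else T.

Fixpoint Bdk (k : nat) (K : {set {set T}}) : {set {set (bdT k)}} :=
  match k return {set {set (bdT k)}} with
  | 0 => K
  | k'.+1 => Bd (Bdk k' K)
  end.

(* The vertex map h acting by v_s |-> v_{h(s)} on iterated subdivisions. *)
Fixpoint bd_map (k : nat) (h : T -> T) : bdT k -> bdT k :=
  match k return bdT k -> bdT k with
  | 0 => h
  | k'.+1 => fun s => @bd_map k' h @: s
  end.

End Iterate.

(* Integral chains are functions {set T} -> int; C_q(K) consists of those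
   supported on [simplices K q]. *)
Notation chain T := {ffun {set T} -> int}.

Definition total_order (T : finType) (le : rel T) : Prop :=
  [/\ reflexive le, antisymmetric le, transitive le & total le].

Local Open Scope ring_scope.

Section Chains.
Variable T : finType.
Implicit Types (s t : {set T}) (c : chain T).

Definition basis s : chain T := [ffun t => (t == s)%:R].

Definition linext (U : finType) (phi : {set T} -> chain U) c : chain U :=
  \sum_(s : {set T}) phi s *~ c s.

Variable le : rel T.

Definition vseq s : seq T := sort le (enum s).

(* The sign of the permutation relating a duplicate-free sequence to its
   increasing rearrangement. *)
Definition order_sign (w : seq T) : int :=
  if [pick u : 'S_(size w) |
       w == [seq tnth (sort_tuple le (in_tuple w)) (u i)
            | i <- enum 'I_(size w)]]
  is Some u then (-1) ^+ u else 0.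

(* The oriented simplex [w_0, ..., w_q], which is 0 if two vertices coincide. *)
Definition oriented (w : seq T) : chain T :=
  if uniq w then basis [set x in w] *~ order_sign w else 0.

Definition incidence s t : int :=
  if [pick x in s | t == s :\ x] is Some x then (-1) ^+ index x (vseq s)
  else 0.

Definition boundary (q : nat) c : chain T :=
  if q is 0 then 0
  else linext (fun s => \sum_(t : {set T}) basis t *~ incidence s t) c.

Definition fundamental_chain (K : {set {set T}}) (d : nat)
    (xi : {set T} -> int) : chain T :=
  \sum_(s in simplices K d) basis s *~ xi s.

Definition is_orientation (K : {set {set T}}) (d : nat)
    (xi : {set T} -> int) : Prop :=
  (forall s, s \in simplices K d -> xi s = 1 \/ xi s = -1) /\
  boundary d (fundamental_chain K d xi) = 0.

Definition cone (x : T) c : chain T := linext (fun s => oriented (x :: vseq s)) c.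

End Chains.

Definition simplicial_chain_map (T U : finType) (leT : rel T) (leU : rel U)
    (f : T -> U) : chain T -> chain U :=
  linext (fun s => oriented leU (map f (vseq leT s))).

Fixpoint sd_simplex (T : finType) (le : rel T) (le' : rel {set T}) (q : nat)
    (s : {set T}) : chain {set T} :=
  if q is q'.+1 then
    cone le' s (linext (sd_simplex le le' q') (boundary le q (basis s)))
  else basis [set s].

Definition sd (T : finType) (le : rel T) (le' : rel {set T}) (q : nat) :
    chain T -> chain {set T} :=
  linext (sd_simplex le le' q).

Section Degree.
Variable T : finType.
(* A total order on the vertices of every iterated subdivision. *)
Variable ord : forall j : nat, rel (bdT T j).

Fixpoint sdk (k q : nat) (c : chain T) : chain (bdT T k) :=
  match k return chain (bdT T k) with
  | 0 => c
  | k'.+1 => sd (@ord k') (@ord k'.+1) q (sdk k' q c)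
  end.

Definition simplicial (U W : finType) (K : {set {set U}}) (L : {set {set W}})
    (f : U -> W) : Prop :=
  forall s, s \in K -> f @: s \in L.

Definition is_degree (k : nat) (K : {set {set T}}) (f : bdT T k -> T)
    (deg : int) : Prop :=
  let d := complex_dim K in
  exists xi : {set (bdT T k)} -> int,
    is_orientation (@ord k) (Bdk k K) d xi /\
    let z := fundamental_chain (Bdk k K) d xi in
    sdk k d (simplicial_chain_map (@ord k) (@ord 0) f z) = z *~ deg.

End Degree.

Section ZpAction.
Variables (p : nat) (T : finType).

(* An action on the vertices is extended to the ambient type; only its
   restriction to cover K matters. *)
Definition Zp_combinatorial_sphere (K : {set {set T}})
    (to : {action 'Z_p &-> T}) : Prop :=
  [/\ exists d, combinatorial_sphere d K,
      [acts [set: 'Z_p], on K | to^*]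
    & forall (g : 'Z_p) (s : {set T}), g != 1%g -> s \in K -> s != set0 ->
        to^*%act s g != s].

Definition iterated_join (m : nat) (S : 'I_m -> {set {set T}}) :
    {set {set T}} :=
  \big[@join T/[set set0]]_(i < m) S i.

(* On the vertices of S_i, g acts as it does on S_i; the image of a simplex
   under this vertex map is then the union of the images of its components. *)
Definition diag_act (m : nat) (S : 'I_m -> {set {set T}})
    (to : 'I_m -> {action 'Z_p &-> T}) (g : 'Z_p) (x : T) : T :=
  if [pick i | x \in cover (S i)] is Some i then to i x g else x.

Definition equivariant (k m : nat) (S : 'I_m -> {set {set T}})
    (to : 'I_m -> {action 'Z_p &-> T}) (f : bdT T k -> T) : Prop :=
  forall (g : 'Z_p) (s : {set (bdT T k)}),
    s \in Bdk k (iterated_join S) ->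
    f @: (bd_map (diag_act S to g) @: s) = diag_act S to g @: (f @: s).

End ZpAction.

(* Main.v *)
From HB Require Import structures.
Require Import Defs.
From mathcomp Require Import all_boot all_order all_algebra all_fingroup.
From mathcomp Require Import zify ring.

(* The composite F of f with the iterated subdivision is an equivariant
   augmented chain endomorphism of K, the join of the spheres.  The action being
   free on nonempty simplices, the supertrace of F over all simplices of K
   (including the empty one) is congruent mod p to the contribution 1 of the
   empty simplex.  On the other hand K carries a perfect acyclic matching with a
   single critical simplex, of top dimension d, so that its reduced homology is
   that of a d-sphere and the Hopf trace formula evaluates the supertrace as
   (-1)^(d+1) deg f.  The same computation for the identity gives
   (-1)^(d+1) = 1 mod p, hence deg f = 1 mod p.

   Signs are handled by identifying the augmented chains of all simplices with
   the exterior algebra on the vertices: oriented simplices are products of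
   vertices and the boundary is a contraction. *)

Set Implicit Arguments.
Unset Strict Implicit.
Unset Printing Implicit Defensive.

Import Order.TTheory GRing.Theory Num.Theory.
Local Open Scope ring_scope.

(** * Chains as an exterior algebra *)

(** The degree is defined through an arbitrary orientation of the subdivision, whereas the trace
    formula only knows the fundamental cycle of K. The bridge is that every top-dimensional cycle of
    Bd^k K is the subdivision of a chain of K; it takes the place of a proof that subdivisions are
    again spheres. Likewise the join is not shown to be a combinatorial sphere: one carries along
    only properties that pass to joins and suffice here, namely a matching perfect off one top
    simplex, and connectivity through facets shared by exactly two top simplices, which forces the
    coefficients of the fundamental cycle to be 1 or -1.

    Keeping the empty simplex makes the argument uniform: matchings combine over joins with unit
    {∅}, subdivision and simplicial maps fix ∅, and ∅ is the only simplex that the group fixes. The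
    price is paid in dimension 0, where the boundary of the definitions vanishes instead of being
    the augmentation. An orientation there need not be a reduced cycle; if it is not, the degree is
    1 because the augmentation is preserved. *)

Section Linear.
Variables T U : finType.
Implicit Types (s t : {set T}) (c : chain T) (phi : {set T} -> chain U).

Lemma linext_is_zmod_morphism phi : zmod_morphism (linext phi).
Proof.
by move=> c c'; rewrite /linext -sumrB; apply: eq_bigr => s _; rewrite !ffunE mulrzBr.
Qed.
HB.instance Definition _ phi :=
  GRing.isZmodMorphism.Build (chain T) (chain U) (linext phi)
    (linext_is_zmod_morphism phi).

Lemma basisE s t : basis s t = (t == s)%:R.
Proof. by rewrite ffunE. Qed.

Lemma linext_basis phi s : linext phi (basis s) = phi s.
Proof.
rewrite /linext (bigD1 s) //= basisE eqxx mulr1z big1 ?addr0 // => t ts.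
by rewrite basisE (negbTE ts).
Qed.

Lemma intz_mul (a b : int) : a *~ b = a * b.
Proof. by rewrite -mulrzr intz. Qed.

Lemma ffunMzE c (n : int) s : (c *~ n) s = c s * n.
Proof.
rewrite -intz_mul; case: n => n.
  by rewrite -!pmulrn ffunMnE.
by rewrite !NegzE !mulrNz ffunE -!pmulrn ffunMnE.
Qed.

Lemma chainE c : c = \sum_s basis s *~ c s.
Proof.
apply/ffunP => t; rewrite sum_ffunE (bigD1 t) //= ffunMzE basisE eqxx mul1r.
by rewrite big1 ?addr0 // => s st; rewrite ffunMzE basisE eq_sym (negbTE st) mul0r.
Qed.

Lemma additive_ext (F G : {additive chain T -> chain U}) :
  (forall s, F (basis s) = G (basis s)) -> F =1 G.
Proof.
move=> FG c; rewrite [c]chainE !raddf_sum; apply: eq_bigr => s _.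
by rewrite !raddfMz FG.
Qed.

Lemma additiveE (F : {additive chain T -> chain U}) c :
  F c = \sum_s F (basis s) *~ c s.
Proof. by rewrite {1}[c]chainE raddf_sum; apply: eq_bigr => s _; rewrite raddfMz. Qed.

End Linear.

Section Support.
Variable T : finType.
Implicit Types (A B : {set {set T}}) (c : chain T).

Definition on A c : Prop := forall s, s \notin A -> c s = 0.

Lemma on0 A : on A 0. Proof. by move=> s _; rewrite ffunE. Qed.
Lemma onD A c c' : on A c -> on A c' -> on A (c + c').
Proof. by move=> h h' s sA; rewrite ffunE h ?h'. Qed.
Lemma onN A c : on A c -> on A (- c).
Proof. by move=> h s sA; rewrite ffunE h ?oppr0. Qed.
Lemma onMz A c (n : int) : on A c -> on A (c *~ n).
Proof. by move=> h s sA; rewrite ffunMzE h ?mul0r. Qed.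
Lemma on_sum A (I : Type) (r : seq I) (P : pred I) (F : I -> chain T) :
  (forall i, P i -> on A (F i)) -> on A (\sum_(i <- r | P i) F i).
Proof. by move=> h; apply: big_ind => //; [exact: on0 | exact: onD]. Qed.
Lemma on_basis A s : s \in A -> on A (basis s).
Proof. by move=> sA t tA; rewrite basisE; case: eqP tA => // ->; rewrite sA. Qed.
Lemma onS A B c : A \subset B -> on A c -> on B c.
Proof. by move=> /subsetP AB h s sB; apply: h; apply: contra sB; apply: AB. Qed.

Lemma on_mem A c s : on A c -> c s != 0 -> s \in A.
Proof. by move=> h; apply: contraR => /h ->. Qed.

Lemma onE A c : on A c -> c = \sum_(s in A) basis s *~ c s.
Proof.
move=> h; rewrite {1}[c]chainE (bigID (mem A)) /= [X in _ + X]big1 ?addr0 //.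
by move=> s /h ->; rewrite mulr0z.
Qed.

End Support.

Lemma on_additive (T U : finType) (A : {set {set T}}) (B : {set {set U}})
    (F : {additive chain T -> chain U}) :
  (forall s, s \in A -> on B (F (basis s))) ->
  forall c, on A c -> on B (F c).
Proof.
move=> h c /onE ->; rewrite raddf_sum; apply: on_sum => s sA.
by rewrite raddfMz; apply: onMz; apply: h.
Qed.

Lemma additive_ext_on (T U : finType) (A : {set {set T}})
    (F G : {additive chain T -> chain U}) :
  (forall s, s \in A -> F (basis s) = G (basis s)) ->
  forall c, on A c -> F c = G c.
Proof.
move=> FG c /onE ->; rewrite !raddf_sum; apply: eq_bigr => s sA.
by rewrite !raddfMz FG.
Qed.

Section Exterior.
Variable T : finType.
Variable le : rel T.
Hypothesis tot : total_order le.
Implicit Types (s t : {set T}) (c : chain T) (x y : T) (w : seq T).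

(** The position of [x] in the increasing list of [x |: s], whether or not [x] lies in [s]. *)
Definition below x s : nat := #|[set y in s | (y != x) && le y x]|.

(** Left exterior multiplication by the vertex [x]; [contr] is the contraction against the dual
    covector. *)
Definition wedge x : chain T -> chain T :=
  linext (fun s => if x \in s then 0 else basis (x |: s) *~ (-1) ^+ below x s).
Definition contr x : chain T -> chain T :=
  linext (fun s => if x \in s then basis (s :\ x) *~ (-1) ^+ below x s else 0).

HB.instance Definition _ x := GRing.Additive.on (wedge x).
HB.instance Definition _ x := GRing.Additive.on (contr x).

(* The augmented boundary: the boundary of a vertex is the empty simplex, so
   this is [boundary le q] for q > 0 only. *)
Definition bdry c : chain T := \sum_x contr x c.

Lemma bdry_is_zmod_morphism : zmod_morphism bdry.
Proof. by move=> c c'; rewrite /bdry -sumrB; apply: eq_bigr => x _; rewrite raddfB. Qed.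
HB.instance Definition _ :=
  GRing.isZmodMorphism.Build (chain T) (chain T) bdry bdry_is_zmod_morphism.

Lemma le_flip x y : x != y -> le y x = ~~ le x y.
Proof.
case: tot => _ anti _ total xy; have := total x y; have := anti x y.
by case: (le x y); case: (le y x) => //= /(_ isT) E; rewrite E eqxx in xy.
Qed.

Lemma below_setU1 x y s : y \notin s -> y != x ->
  below x (y |: s) = (le y x + below x s)%N.
Proof.
move=> ys yx; rewrite /below; case lyx: (le y x).
  rewrite (_ : [set _ in _ | _] = y |: [set y0 in s | (y0 != x) && le y0 x]).
    by rewrite cardsU1 inE (negbTE ys).
  by apply/setP => z; rewrite !inE; case: (z =P y) => [->|] //=; rewrite yx lyx.
rewrite add0n; apply: eq_card => z; rewrite !inE.
by case: (z =P y) => [->|] //=; rewrite lyx !andbF.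
Qed.

Lemma below_setU1x x s : below x (x |: s) = below x s.
Proof.
apply: eq_card => z; rewrite !inE.
by case: (z =P x); rewrite ?andbF.
Qed.

Lemma sqr_sign (n : nat) : (-1) ^+ n * (-1) ^+ n = 1 :> int.
Proof. by rewrite -expr2 exprAC sqrrN !expr1n. Qed.

Lemma wedge_basis x s :
  wedge x (basis s) = if x \in s then 0 else basis (x |: s) *~ (-1) ^+ below x s.
Proof. exact: linext_basis. Qed.
Lemma contr_basis x s :
  contr x (basis s) = if x \in s then basis (s :\ x) *~ (-1) ^+ below x s else 0.
Proof. exact: linext_basis. Qed.

Lemma mulrzM (V : zmodType) (v : V) (a b : int) : v *~ a *~ b = v *~ (a * b).
Proof. by rewrite mulrzA. Qed.

Lemma wedge_anti x y c : wedge x (wedge y c) = - wedge y (wedge x c).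
Proof.
pose F : {additive chain T -> chain T} := wedge x \o wedge y.
pose G : {additive chain T -> chain T} := \- (wedge y \o wedge x).
suff FG : F =1 G by exact: (FG c).
apply: additive_ext => s; rewrite /F /G /=.
rewrite !wedge_basis; case: (boolP (y \in s)) => ys; case: (boolP (x \in s)) => xs.
- by rewrite !raddf0 ?oppr0.
- by rewrite raddf0 raddfMz /= wedge_basis !inE ys orbT mul0rz ?oppr0.
- by rewrite raddf0 raddfMz /= wedge_basis !inE xs orbT mul0rz ?oppr0.
rewrite !raddfMz /= !wedge_basis !inE (negbTE xs) (negbTE ys) !orbF (eq_sym x y).
case: (y =P x) => [yx|/eqP yx].
  by rewrite yx ?oppr0 !mul0rz ?oppr0.
rewrite setUCA mulNrz !mulrzM -mulrNz; congr (_ *~ _).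
rewrite !below_setU1 // 1?eq_sym // (le_flip yx) !exprD.
by case: (le y x) => /=; rewrite ?expr0 ?expr1; ring.
Qed.

(** The canonical anticommutation relation. Of two distinct vertices exactly one precedes the other,
    so exactly one of the two orders of operation picks up an extra sign. *)
Lemma contr_wedge x y c : contr x (wedge y c) = c *+ (x == y) - wedge y (contr x c).
Proof.
pose F : {additive chain T -> chain T} := (contr x \o wedge y) \+ (wedge y \o contr x).
pose G : {additive chain T -> chain T} :=
  if x == y then (idfun : {additive chain T -> chain T}) else \0.
suff FG : F =1 G.
  apply: (addIr (wedge y (contr x c))); rewrite subrK; rewrite [LHS](FG c) /G.
  by case: eqP.
apply: additive_ext => s; rewrite /F /G /=.
rewrite wedge_basis contr_basis; case: (x =P y) => [<-|/eqP xy] /=.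
  case: (boolP (x \in s)) => xs; rewrite raddf0 ?addr0 ?add0r raddfMz /=.
    rewrite wedge_basis !inE eqxx /= mulrzM setD1K // -[in X in _ * X](setD1K xs).
    by rewrite below_setU1x sqr_sign mulr1z.
  rewrite contr_basis !inE eqxx /= mulrzM setU1K // below_setU1x.
  by rewrite sqr_sign mulr1z.
have yx : y != x by rewrite eq_sym.
case: (boolP (y \in s)) => ys; case: (boolP (x \in s)) => xs;
  rewrite ?raddf0 ?addr0 ?add0r //= !raddfMz /=.
- by rewrite wedge_basis !inE ys yx mul0rz.
- rewrite contr_basis.
  rewrite wedge_basis !inE xs (negbTE ys) orbT andbF !mulrzM.
  have -> : (y |: s) :\ x = y |: (s :\ x).
    by apply/setP => z; rewrite !inE; case: (z =P y) => [->|//]; rewrite yx.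
  rewrite -mulrzDr -[RHS](mulr0z (basis (y |: s :\ x))); congr (_ *~ _).
  rewrite below_setU1 // -{2}(setD1K xs) below_setU1 ?setD11 //.
  rewrite (le_flip yx) !exprD; case: (le y x) => /=; rewrite ?expr0 ?expr1; ring.
- by rewrite contr_basis !inE (negbTE xs) (negbTE xy) mul0rz.
Qed.

(** The anticommutation relation summed over all contractions. In particular a cycle [c] bounds the
    cone [wedge x c]. *)
Lemma bdry_wedge x c : bdry (wedge x c) = c - wedge x (bdry c).
Proof.
rewrite /bdry (raddf_sum (wedge x)) -sumrN [in RHS](bigD1 x) //= addrA.
rewrite (bigD1 x) //= contr_wedge eqxx; congr (_ + _).
by apply: eq_bigr => y yx; rewrite contr_wedge (negbTE yx) add0r.
Qed.

Lemma contr_set0 x : contr x (basis set0) = 0.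
Proof. by rewrite contr_basis inE. Qed.
Lemma bdry_set0 : bdry (basis set0) = 0.
Proof. by rewrite /bdry big1 // => x _; exact: contr_set0. Qed.

Definition word w : chain T := foldr wedge (basis set0) w.

Lemma word_sorted w : sorted le w -> uniq w -> word w = basis [set x in w].
Proof.
case: tot => _ anti trans _.
elim: w => [|x w IH] /=; first by move=> _ _; congr basis; apply/setP => x; rewrite !inE.
move=> pw /andP[xw uw]; rewrite IH ?(path_sorted pw) // wedge_basis inE (negbTE xw).
suff -> : below x [set y in w] = 0%N.
  by rewrite mulr1z; congr basis; apply/setP => y; rewrite !inE.
apply/eqP; rewrite cards_eq0; apply/eqP/setP => y; rewrite !inE.
apply/and3P => -[yw yx lyx]; move/negP: yx; apply; apply/eqP/anti.
by rewrite lyx (allP (order_path_min trans pw)).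
Qed.

Lemma vseq_sorted s : sorted le (vseq le s).
Proof. by case: tot => _ _ _ total; apply: sort_sorted. Qed.
Lemma vseq_uniq s : uniq (vseq le s).
Proof. by rewrite sort_uniq enum_uniq. Qed.
Lemma mem_vseq s x : (x \in vseq le s) = (x \in s).
Proof. by rewrite mem_sort mem_enum. Qed.

Lemma word_vseq s : word (vseq le s) = basis s.
Proof.
rewrite word_sorted ?vseq_sorted ?vseq_uniq //; congr basis.
by apply/setP => x; rewrite inE mem_vseq.
Qed.

(** An induction principle: words span all chains, so an identity is checked on the empty simplex
    and carried through one more vertex. *)
Lemma wedge_ext (U : finType) (F G : {additive chain T -> chain U}) :
  F (basis set0) = G (basis set0) ->
  (forall x c, F c = G c -> F (wedge x c) = G (wedge x c)) -> F =1 G.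
Proof.
move=> h0 hw; apply: additive_ext => s; rewrite -word_vseq.
by elim: (vseq le s) => //= x w; apply: hw.
Qed.

Lemma bdry_contr x c : bdry (contr x c) = - contr x (bdry c).
Proof.
pose F : {additive chain T -> chain T} := bdry \o contr x.
pose G : {additive chain T -> chain T} := \- (contr x \o bdry).
suff FG : F =1 G by exact: (FG c).
apply: wedge_ext => [|y a]; rewrite /F /G /=.
  by rewrite contr_set0 bdry_set0 !raddf0 ?oppr0.
rewrite bdry_wedge contr_wedge !raddfB /= bdry_wedge contr_wedge raddfMn /= => ->.
by rewrite raddfN /= !opprK opprD addrCA.
Qed.

Lemma bdry_bdry c : bdry (bdry c) = 0.
Proof.
pose F : {additive chain T -> chain T} := bdry \o bdry.
pose G : {additive chain T -> chain T} := \0.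
suff FG : F =1 G by exact: (FG c).
apply: wedge_ext => [|y a]; rewrite /F /G /=.
  by rewrite bdry_set0 raddf0.
by move=> h; rewrite bdry_wedge raddfB /= bdry_wedge h raddf0 subr0 subrr.
Qed.

(** Anticommutation gives [v = - v], and integers have no 2-torsion. *)
Lemma wedge_wedge x c : wedge x (wedge x c) = 0.
Proof.
have := wedge_anti x x c; move: (wedge x (wedge x c)) => v /ffunP v2.
apply/ffunP => s; move: (v2 s); rewrite !ffunE.
by move: (v s : int) => a; lia.
Qed.

Lemma wedge_contr_basis x s : wedge x (contr x (basis s)) = basis s *+ (x \in s).
Proof.
have := contr_wedge x x (basis s); rewrite eqxx mulr1n wedge_basis contr_basis.
case: ifP => xs; last by rewrite raddf0.
by rewrite raddf0 => /esym/eqP; rewrite subr_eq0 => /eqP <-.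
Qed.

Lemma word_move w1 x w2 :
  word (w1 ++ x :: w2) = word (x :: w1 ++ w2) *~ (-1) ^+ size w1.
Proof.
elim: w1 => [|y w1 IH] /=; first by rewrite mulr1z.
by rewrite IH raddfMz /= wedge_anti exprS mulN1r mulNrz mulrNz.
Qed.

Lemma word_dup x w : x \in w -> word (x :: w) = 0.
Proof.
case/splitPr => w1 w2; rewrite /= -/(word _) word_move raddfMz /=.
by rewrite wedge_wedge mul0rz.
Qed.

Lemma word_nuniq w : ~~ uniq w -> word w = 0.
Proof.
elim: w => //= x w IH; rewrite negb_and negbK => /orP[xw|/IH ->].
  exact: word_dup.
exact: raddf0.
Qed.

End Exterior.

(** * Agreement with the signs of the definitions *)

Section Oriented.
Variable T : finType.
Variable le : rel T.
Hypothesis tot : total_order le.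
Implicit Types (s t : {set T}) (c : chain T) (x y : T) (w : seq T).

Lemma sort_cons x w : uniq (x :: w) -> exists w1 w2,
  sort le (x :: w) = w1 ++ x :: w2 /\ sort le w = w1 ++ w2.
Proof.
case: (tot) => _ anti trans total uw.
have xS : x \in sort le (x :: w) by rewrite mem_sort mem_head.
have sS : sorted le (sort le (x :: w)) by exact: sort_sorted.
have pS : perm_eq (sort le (x :: w)) (x :: w) by rewrite perm_sort.
case/splitPr: xS sS pS => w1 w2 sS pS; exists w1, w2; split=> //.
apply: (sorted_eq trans anti (sort_sorted total w)).
  apply: subseq_sorted sS => //; apply: cat_subseq => //; exact: subseq_cons.
rewrite perm_sort -(perm_cons x) -(permPl pS).
by rewrite -[x :: _ ++ _]/([:: x] ++ w1 ++ w2) -[x :: w2]cat1s perm_catCA.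
Qed.

Lemma nth_bump (x0 x : T) w1 w2 k :
  nth x0 (w1 ++ x :: w2) (bump (size w1) k) = nth x0 (w1 ++ w2) k.
Proof.
rewrite /bump !nth_cat; case: (leqP (size w1) k) => h; last by rewrite add0n h.
by rewrite add1n ltnNge (leqW h) /= subSn.
Qed.

(* Peeling off the head of w amounts to writing its sorting permutation as a
   [lift_perm], whose parity is known. *)
Lemma word_sort n w : size w = n -> uniq w -> exists u : 'S_n,
  (forall x0 (i : 'I_n), nth x0 w i = nth x0 (sort le w) (u i)) /\
  word le w = word le (sort le w) *~ (-1) ^+ u.
Proof.
elim: n w => [|n IH] [|x w] //=; first by exists 1%g; split=> [? []|] //; rewrite odd_perm1.
case=> sw uw; have [u [hu hw]] := IH w sw (proj2 (andP uw)).
have [w1 [w2 [e1 e2]]] := sort_cons uw.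
have sz : size (w1 ++ x :: w2) = n.+1 by rewrite -e1 size_sort /= sw.
have jn : (size w1 < n.+1)%N by rewrite -sz size_cat /= addnS ltnS leq_addr.
exists (lift_perm ord0 (Ordinal jn) u); split.
  move=> x0 i; rewrite e1; case: (unliftP ord0 i) => [i' ->|->].
    by rewrite lift_perm_lift /= hu e2 nth_bump.
  by rewrite lift_perm_id /= nth_cat ltnn subnn.
rewrite e1 hw e2 raddfMz /= word_move // odd_lift_perm /= mulrzM.
congr (_ *~ _).
by rewrite signr_addb signr_odd mulrA sqr_sign mul1r.
Qed.

(** The permutation picked by [order_sign] is the one of [word_sort], since distinct entries
    determine their positions in the sorted list. *)
Lemma order_signE w : uniq w -> word le w = word le (sort le w) *~ order_sign le w.
Proof.
move=> uw; have [u [hu ->]] := word_sort erefl uw; congr (_ *~ _).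
case: w => [|x0 w] in uw u hu *.
  rewrite /order_sign; case: pickP => [v _|/(_ 1%g)] /=.
    by rewrite (_ : u = v) //; apply/permP => -[].
  by rewrite (_ : enum _ = [::]) //; apply/size0nil; rewrite size_enum_ord.
set W := x0 :: w in uw u hu *; rewrite /order_sign; case: pickP => [v /eqP hv|/(_ u)].
  congr (_ ^+ odd_perm _); apply/permP => i; apply/val_inj/eqP.
  rewrite -(@nth_uniq _ x0 (sort le W)) ?sort_uniq ?size_sort ?ltn_ord // -hu.
  rewrite [X in nth _ X]hv (nth_map i) ?size_enum_ord // nth_ord_enum.
  by rewrite (tnth_nth x0).
case/eqP; apply: (@eq_from_nth _ x0); first by rewrite size_map size_enum_ord.
move=> i iW; rewrite (nth_map (Ordinal iW)) ?size_enum_ord //.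
rewrite (tnth_nth x0) /=; have := hu x0 (Ordinal iW); rewrite /= => ->.
by congr (nth _ _ (u _)); apply/val_inj; rewrite /= nth_enum_ord.
Qed.

Lemma orientedE w : oriented le w = word le w.
Proof.
rewrite /oriented; case: (boolP (uniq w)) => uw; last by rewrite word_nuniq.
case: (tot) => _ _ _ total.
rewrite order_signE // (word_sorted tot) ?sort_uniq //; last exact: sort_sorted.
by congr (basis _ *~ _); apply/setP => x; rewrite !inE mem_sort.
Qed.

Lemma coneE x c : cone le x c = wedge le x c.
Proof.
pose F : {additive chain T -> chain T} := linext (fun s => oriented le (x :: vseq le s)).
suff FG : F =1 wedge le x by exact: (FG c).
by apply: additive_ext => s; rewrite /F /= linext_basis orientedE /= word_vseq.
Qed.

Lemma index_vseq x s : x \in s -> index x (vseq le s) = below le x s.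
Proof.
case: (tot) => _ anti trans _ xs.
have -> : below le x s = count (fun y => (y != x) && le y x) (vseq le s).
  rewrite /below cardE -size_filter; apply: perm_size.
  apply: uniq_perm; rewrite ?enum_uniq ?filter_uniq ?vseq_uniq // => y.
  by rewrite mem_enum !inE mem_filter mem_vseq andbC.
have:= vseq_sorted tot s; have:= vseq_uniq le s.
have : x \in vseq le s by rewrite mem_vseq.
case/splitPr => w1 w2; rewrite cat_uniq /= negb_or => /and4P[_ /andP[xw1 _] xw2 _].
rewrite (sorted_pairwise trans) pairwise_cat /= => /and4P[h _ h2 _].
rewrite index_cat (negbTE xw1) /= eqxx addn0 count_cat /= eqxx /= add0n.
rewrite (eq_in_count (a2 := predT)) ?count_predT => [|y yw1]; last first.
  rewrite (allrelP h) ?mem_head //= andbT.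
  by apply: contraNneq xw1 => <-.
rewrite (eq_in_count (a2 := pred0)) ?count_pred0 ?addn0 // => y yw2 /=.
apply/negP => /andP[yx lyx]; move/negP: yx; apply; apply/eqP/anti.
by rewrite lyx (allP h2).
Qed.

Lemma incidenceE s t : incidence le s t = bdry le (basis s) t.
Proof.
rewrite /bdry sum_ffunE /incidence; case: pickP => [x /andP[xs /eqP ->]|none].
  rewrite (bigD1 x) //= contr_basis xs ffunMzE basisE eqxx mul1r index_vseq //.
  rewrite big1 ?addr0 // => y yx; rewrite contr_basis; case: ifP => ys; last by rewrite ffunE.
  rewrite ffunMzE basisE; case: eqP => [/setP/(_ y)|_]; last by rewrite mul0r.
  by rewrite !inE eqxx ys yx.
rewrite big1 // => y _; rewrite contr_basis; case: ifP => ys; last by rewrite ffunE.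
rewrite ffunMzE basisE; case: eqP => [E|_]; last by rewrite mul0r.
by have := none y; rewrite ys E eqxx.
Qed.

Lemma boundaryE q c : boundary le q.+1 c = bdry le c.
Proof.
pose F : {additive chain T -> chain T} :=
  linext (fun s => \sum_(t : {set T}) basis t *~ incidence le s t).
suff FG : F =1 bdry le by exact: (FG c).
apply: additive_ext => s; rewrite /F /= linext_basis [RHS]chainE.
by apply: eq_bigr => t _; rewrite incidenceE.
Qed.

End Oriented.

(** * Simplicial maps *)

Section Facets.
Variable T : finType.
Variable le : rel T.
Hypothesis tot : total_order le.
Implicit Types (K : {set {set T}}) (s t : {set T}) (c : chain T).

(** Graded by cardinality: the empty simplex sits in degree 0, and [layer K q.+1] is
    [simplices K q]. *)
Definition layer K n : {set {set T}} := [set s in K | #|s| == n].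
Definition closed_sub K : Prop := forall s t, s \in K -> t \subset s -> t \in K.
Definition bounded n K : Prop := forall s, s \in K -> (#|s| <= n)%N.

Lemma is_facetP s t : reflect (exists2 x, x \in t & s = t :\ x) (is_facet s t).
Proof.
apply: (iffP andP) => [[st /eqP ct]|[x xt ->]]; last first.
  by rewrite subD1set [#|t|](cardsD1 x) xt.
have /set0Pn[x] : t :\: s != set0 by rewrite -card_gt0 cardsDS // ct subSn // subnn.
rewrite inE => /andP[xs xt]; exists x => //; apply/eqP.
rewrite eqEcard subsetD1 st xs /=.
by move: (cardsD1 x t); rewrite xt ct add1n => -[->].
Qed.

(** The coefficient is a sign, recorded through its square because this is the form in which it gets
    cancelled. *)
Lemma bdry_coef_facet s t : is_facet t s -> bdry le (basis s) t * bdry le (basis s) t = 1.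
Proof.
case/is_facetP => x xs ->; rewrite -incidenceE // /incidence.
case: pickP => [y _|/(_ x)]; first exact: sqr_sign.
by rewrite xs eqxx.
Qed.

Lemma bdry_basis_on s : on [set t | is_facet t s] (bdry le (basis s)).
Proof.
move=> t; rewrite inE => /negP ts; rewrite -incidenceE // /incidence.
case: pickP => [y /andP[ys /eqP e]|] //; case: ts; apply/is_facetP.
by exists y.
Qed.

Lemma bdry_on K n c : closed_sub K -> on (layer K n.+1) c -> on (layer K n) (bdry le c).
Proof.
move=> cl; apply: on_additive => s; rewrite inE => /andP[sK /eqP sn].
apply: onS (@bdry_basis_on s); apply/subsetP => t; rewrite !inE => /andP[ts].
by rewrite sn eqSS eq_sym => ->; rewrite (cl s).
Qed.

(** Induction on the cardinality, suited to maps defined on a simplex through its boundary, as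
    subdivision is. *)
Lemma facet_ext (U : finType) (F G : {additive chain T -> chain U}) :
  F (basis set0) = G (basis set0) ->
  (forall s, s != set0 -> F (bdry le (basis s)) = G (bdry le (basis s)) ->
     F (basis s) = G (basis s)) -> F =1 G.
Proof.
move=> h0 h; apply: additive_ext => s.
have [n] := ubnP #|s|; elim: n s => // n IH s; rewrite ltnS => sn.
have [->//|s0] := eqVneq s set0; apply: h => //.
apply: additive_ext_on (@bdry_basis_on s) => t; rewrite inE => /andP[_ /eqP ts].
by apply: IH; rewrite -ts.
Qed.

Lemma wedgeE x c s :
  wedge le x c s = if x \in s then c (s :\ x) * (-1) ^+ below le x s else 0.
Proof.
rewrite additiveE sum_ffunE; case: ifP => xs.
  rewrite (bigD1 (s :\ x)) //= ffunMzE wedge_basis setD11 ffunMzE setD1K // basisE eqxx.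
  rewrite mul1r -(below_setU1x le x (s :\ x)) setD1K // mulrC big1 ?addr0 // => t ts.
  rewrite ffunMzE /= wedge_basis; case: ifP => xt; first by rewrite ffunE mul0r.
  rewrite ffunMzE basisE; case: eqP => [e|_]; last by rewrite !mul0r.
  by rewrite e setU1K ?xt ?eqxx in ts.
rewrite big1 // => t _; rewrite ffunMzE /= wedge_basis.
case: ifP => xt; first by rewrite ffunE mul0r.
rewrite ffunMzE basisE; case: eqP => [e|_]; last by rewrite !mul0r.
by rewrite e setU11 in xs.
Qed.

Lemma bdry_vertex x : bdry le (basis [set x]) = basis set0.
Proof.
rewrite /bdry (bigD1 x) //= big1 => [|y yx]; last first.
  by rewrite contr_basis inE (negbTE yx).
rewrite addr0 contr_basis inE eqxx setDv (_ : below le x [set x] = 0%N) ?mulr1z //.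
by apply/eqP; rewrite cards_eq0; apply/eqP/setP => y; rewrite !inE; case: eqP.
Qed.

End Facets.

Section SimplicialMaps.
Variables T U : finType.
Variables (leT : rel T) (leU : rel U).
Hypotheses (totT : total_order leT) (totU : total_order leU).
Implicit Types (s : {set T}) (c : chain T) (f g : T -> U).

Local Notation smap f := (simplicial_chain_map leT leU f).
HB.instance Definition _ f := GRing.Additive.on (smap f).

Lemma smap_basis f s : smap f (basis s) = word leU (map f (vseq leT s)).
Proof. by rewrite -orientedE //; exact: linext_basis. Qed.

Lemma smap_set0 f : smap f (basis set0) = basis set0.
Proof.
rewrite smap_basis (_ : vseq _ _ = [::]) //.
by apply/size0nil; rewrite size_sort -cardE cards0.
Qed.

(** A simplicial map is a homomorphism of exterior algebras; degenerate simplices go to 0 because a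
    repeated factor kills a word. *)
Lemma smap_wedge f x c : smap f (wedge leT x c) = wedge leU (f x) (smap f c).
Proof.
pose F : {additive chain T -> chain U} := smap f \o wedge leT x.
pose G : {additive chain T -> chain U} := wedge leU (f x) \o smap f.
suff FG : F =1 G by exact: (FG c).
apply: additive_ext => s; rewrite /F /G /= smap_basis wedge_basis; case: ifP => xs.
  rewrite raddf0 -[RHS]/(word leU (f x :: map f (vseq leT s))) word_dup //.
  by rewrite map_f // mem_vseq.
(* The increasing list of [x |: s] is [w1 ++ x :: w2]. Moving the image of [x] to the front costs
   [size w1] signs, the exponent already present in [wedge]. *)
have eV : vseq leT (x |: s) = sort leT (x :: enum s).
  case: (totT) => _ anti trans total; apply/perm_sortP => //.
  apply: uniq_perm; rewrite /= ?enum_uniq ?mem_enum ?xs //= => y.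
  by rewrite in_cons !mem_enum !inE.
have [|w1 [w2 [e1 e2]]] := @sort_cons _ _ totT x (enum s).
  by rewrite /= enum_uniq mem_enum xs.
rewrite raddfMz /= smap_basis eV e1 /vseq e2 !map_cat /= word_move // size_map.
rewrite mulrzM -(below_setU1x leT) -index_vseq ?setU11 // eV e1.
have xw1 : x \notin w1.
  have := mem_vseq leT s x; rewrite /vseq e2 mem_cat xs.
  by case: (x \in w1).
by rewrite index_cat (negbTE xw1) /= eqxx addn0 sqr_sign mulr1z.
Qed.

Lemma smap_bdry f c : smap f (bdry leT c) = bdry leU (smap f c).
Proof.
pose F : {additive chain T -> chain U} := smap f \o bdry leT.
pose G : {additive chain T -> chain U} := bdry leU \o smap f.
suff FG : F =1 G by exact: (FG c).
apply: (wedge_ext totT) => [|x a]; rewrite /F /G /=.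
  by rewrite smap_set0 !bdry_set0 raddf0.
by move=> h; rewrite smap_wedge !bdry_wedge // raddfB /= smap_wedge h.
Qed.

Lemma smap_word f w : smap f (word leT w) = word leU (map f w).
Proof. by elim: w => [|x w IH] /=; rewrite ?smap_set0 // smap_wedge IH. Qed.

Lemma smap_eq f g s : {in s, f =1 g} -> smap f (basis s) = smap g (basis s).
Proof.
move=> fg; rewrite !smap_basis; congr word; apply/eq_in_map => x.
by rewrite mem_vseq; apply: fg.
Qed.

Lemma smap_basisP f s : [\/ smap f (basis s) = 0,
  #|f @: s| = #|s| /\ smap f (basis s) = basis (f @: s) |
  #|f @: s| = #|s| /\ smap f (basis s) = - basis (f @: s)].
Proof.
rewrite smap_basis -orientedE // /oriented; case: ifP => uw; last by constructor 1.
have e : [set y in [seq f x | x <- vseq leT s]] = f @: s.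
  apply/setP => y; rewrite inE; apply/mapP/imsetP => -[x]; rewrite ?mem_vseq => xs ->.
    by exists x.
  by exists x; rewrite ?mem_vseq.
have cs : #|f @: s| = #|s|.
  by rewrite -e cardsE (card_uniqP uw) size_map size_sort cardE.
rewrite e /order_sign; case: pickP => [u _|_]; last by rewrite mulr0z; constructor 1.
case: odd_perm; rewrite ?expr1 ?expr0 ?mulrN1z ?mulr1z; first by constructor 3.
by constructor 2.
Qed.

Lemma smap_on f (K : {set {set T}}) (L : {set {set U}}) n c :
  (forall s, s \in K -> f @: s \in L) ->
  on (layer K n) c -> on (layer L n) (smap f c).
Proof.
move=> fKL; apply: on_additive => s; rewrite inE => /andP[sK /eqP sn].
have fs : #|f @: s| = #|s| -> f @: s \in layer L n by move=> e; rewrite inE e sn eqxx fKL.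
rewrite /=; case: (smap_basisP f s) => [->|[/fs h ->]|[/fs h ->]]; 
  [exact: on0 | exact: on_basis | by apply: onN; apply: on_basis].
Qed.

Lemma smap_inj f s : {in s &, injective f} ->
  exists2 e : int, e * e = 1 & smap f (basis s) = basis (f @: s) *~ e.
Proof.
move=> inj; rewrite smap_basis -orientedE // /oriented.
have uw : uniq [seq f x | x <- vseq leT s].
  rewrite map_inj_in_uniq ?vseq_uniq // => x y; rewrite !mem_vseq; exact: inj.
rewrite uw; have e : [set y in [seq f x | x <- vseq leT s]] = f @: s.
  apply/setP => y; rewrite inE; apply/mapP/imsetP => -[x]; rewrite ?mem_vseq => xs ->.
    by exists x.
  by exists x; rewrite ?mem_vseq.
rewrite e; exists (order_sign leU [seq f x | x <- vseq leT s]) => //.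
(* [order_sign] is a search with default 0; comparison with [word_sort] shows that it is the sign of
   a permutation. *)
have [u [_ hw]] := word_sort totU erefl uw.
have := order_signE totU uw; rewrite {1}hw word_sorted ?sort_uniq //; last first.
  by case: (totU) => _ _ _ total; exact: sort_sorted.
move=> /ffunP/(_ [set x in sort leU [seq f x | x <- vseq leT s]]).
rewrite !ffunMzE basisE eqxx !mul1r => <-; exact: sqr_sign.
Qed.

Lemma smap_coef f c s : injective f ->
  smap f c (f @: s) = c s * smap f (basis s) (f @: s).
Proof.
move=> inj; rewrite additiveE sum_ffunE (bigD1 s) //= ffunMzE mulrC big1 ?addr0 //.
move=> t ts; rewrite ffunMzE; have [|e _ ->] := @smap_inj f t; first by move=> ? ? _ _ /inj.
rewrite ffunMzE basisE; case: eqP => [/(imset_inj inj) E|_]; last by rewrite !mul0r.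
by rewrite E eqxx in ts.
Qed.

End SimplicialMaps.

Lemma smap_comp (T U W : finType) (leT : rel T) (leU : rel U) (leW : rel W)
    (f : T -> U) (g : U -> W) c :
  total_order leT -> total_order leU -> total_order leW ->
  simplicial_chain_map leU leW g (simplicial_chain_map leT leU f c) =
  simplicial_chain_map leT leW (g \o f) c.
Proof.
move=> tT tU tW.
pose F : {additive chain T -> chain W} :=
  simplicial_chain_map leU leW g \o simplicial_chain_map leT leU f.
suff FG : F =1 simplicial_chain_map leT leW (g \o f) by exact: (FG c).
apply: additive_ext => s; rewrite /F /= (smap_basis _ tU) (smap_word tU tW).
by rewrite (smap_basis _ tW) map_comp.
Qed.

(** * Barycentric subdivision *)

Section Nested.
Variable T : finType.
Implicit Types (s t : {set T}) (c d : {set {set T}}).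

Definition nested c : bool :=
  [forall s in c, forall t in c, (s \subset t) || (t \subset s)].

Lemma nestedP c : reflect {in c &, forall s t, (s \subset t) || (t \subset s)} (nested c).
Proof.
apply: (iffP forall_inP) => h s; first by move=> t sc tc; apply: (forall_inP (h s sc)).
by move=> sc; apply/forall_inP => t; apply: h.
Qed.

Lemma nested_sub c d : c \subset d -> nested d -> nested c.
Proof. by move=> /subsetP cd /nestedP h; apply/nestedP => s t /cd sd /cd; apply: h. Qed.

Lemma nested_card_eq c s t : nested c -> s \in c -> t \in c -> #|s| = #|t| -> s = t.
Proof.
move=> /nestedP h sc tc e; case/orP: (h _ _ sc tc) => st; apply/eqP.
  by rewrite eqEcard st e leqnn.
by rewrite eq_sym eqEcard st e leqnn.
Qed.

(** Cardinality is injective on a chain of sets, here with values between 1 and [m]. *)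
Lemma nested_card_le c m : nested c -> {in c, forall s, 0 < #|s| <= m}%N -> (#|c| <= m)%N.
Proof.
move=> nc h; rewrite cardE -(size_map (fun s => #|s|)) -(size_iota 1 m).
apply: uniq_leq_size.
  rewrite map_inj_in_uniq ?enum_uniq // => s t; rewrite !mem_enum; exact: nested_card_eq.
by move=> k /mapP[s]; rewrite mem_enum mem_iota add1n ltnS => /h ? ->.
Qed.

Lemma nested_top c m : nested c -> {in c, forall s, 0 < #|s| <= m}%N -> #|c| = m ->
  (0 < m)%N -> exists t, [/\ t \in c, #|t| = m & {in c, forall s, s \subset t}].
Proof.
move=> nc h cm m0; have [/existsP[t /andP[tc /eqP tm]]|/existsPn no] :=
  boolP [exists t, (t \in c) && (#|t| == m)].
  exists t; split=> // s sc; case/orP: (nestedP _ nc _ _ sc tc) => // ts.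
  rewrite (nested_card_eq nc sc tc) //; apply/eqP; rewrite eqn_leq (subset_leq_card ts).
  by rewrite tm andbT; case/andP: (h _ sc).
suff : (#|c| <= m.-1)%N by rewrite cm; case: (m) m0 => // k _; rewrite ltnn.
apply: nested_card_le => // s sc; have /andP[-> sm] := h _ sc; rewrite /=.
have := no s; rewrite sc /= => ne.
by rewrite -ltnS prednK // ltn_neqAle ne.
Qed.

(* A maximal chain of nonempty faces of s. *)
Definition flag c s : bool :=
  [&& #|c| == #|s|, nested c & [forall t in c, (t != set0) && (t \subset s)]].

Lemma flagP c s : reflect
  [/\ #|c| = #|s|, nested c & {in c, forall t, t != set0 /\ t \subset s}] (flag c s).
Proof.
apply: (iffP and3P) => -[h1 h2 h3]; split=> //; try exact/eqP.
  by move=> t tc; apply/andP; apply: (forall_inP h3).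
by apply/forall_inP => t /h3 [-> ->].
Qed.

Lemma flag_top c s : flag c s -> s != set0 -> s \in c.
Proof.
case/flagP => cs nc h s0.
have h1 : {in c, forall t, 0 < #|t| <= #|s|}%N.
  by move=> t /h [t0 /subset_leq_card ->]; rewrite card_gt0 t0.
have [|t [tc ts _]] := nested_top nc h1 cs; first by rewrite card_gt0.
have [_ sub] := h _ tc.
suff -> : s = t by exact: tc.
by apply/esym/eqP; rewrite eqEcard sub ts leqnn.
Qed.

Lemma flag_inj c s t : flag c s -> flag c t -> s = t.
Proof.
move=> fs ft; have [cs nc _] := flagP _ _ fs; have [ct _ _] := flagP _ _ ft.
have e : #|s| = #|t| by rewrite -cs.
have [s0|s0] := eqVneq s set0.
  by apply/eqP; rewrite s0 eq_sym -cards_eq0 -e s0 cards0.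
have t0 : t != set0 by rewrite -card_gt0 -e card_gt0.
exact: nested_card_eq nc (flag_top fs s0) (flag_top ft t0) e.
Qed.

(** Once the top is removed the remaining cardinalities fill up 1, ..., [#|s|.-1], so the next
    largest member is a facet. For a vertex this facet is the empty simplex. *)
Lemma flag_facet c s : flag c s -> s != set0 ->
  exists2 t, is_facet t s & flag (c :\ s) t.
Proof.
move=> fs s0; have sc := flag_top fs s0; have [cs nc h] := flagP _ _ fs.
have nc' : nested (c :\ s) by apply: nested_sub nc; exact: subD1set.
have cs' : #|c :\ s| = #|s|.-1 by rewrite -cs (cardsD1 s c) sc.
have [s1|s1] := posnP #|s|.-1.
  exists set0; first by rewrite /is_facet sub0set cards0 -[#|s|]prednK ?card_gt0 // s1.
  apply/flagP; split=> //; first by rewrite cs' s1 cards0.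
  by move=> t; rewrite s1 in cs'; rewrite (cards0_eq cs') inE.
have h1 : {in c :\ s, forall t, 0 < #|t| <= #|s|.-1}%N.
  move=> t; rewrite !inE => /andP[ts /h[t0 sts]]; rewrite card_gt0 t0 /=.
  by rewrite -ltnS prednK ?card_gt0 // proper_card // properEneq ts.
have [t [tc ts sub]] := nested_top nc' h1 cs' s1.
have [_ tsub] := h t (subsetP (subD1set c s) _ tc).
exists t; first by rewrite /is_facet tsub ts prednK ?eqxx ?card_gt0.
apply/flagP; split=> [||u uc] //; first by rewrite ts.
by split; [have [] := h u (subsetP (subD1set c s) _ uc) | exact: sub].
Qed.

Lemma flag_setU1 c s t : is_facet t s -> flag c t -> flag (s |: c) s /\ s \notin c.
Proof.
case/andP => ts /eqP cts /flagP[ct nc h].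
have sc : s \notin c.
  by apply/negP => /h[_ /subset_leq_card]; rewrite cts ltnn.
split=> //; apply/flagP; split; first by rewrite cardsU1 sc ct cts.
  apply/nestedP => u v; rewrite !inE => /orP[/eqP ->|uc] /orP[/eqP ->|vc].
  - by rewrite subxx.
  - by rewrite (subset_trans (h _ vc).2 ts) orbT.
  - by rewrite (subset_trans (h _ uc).2 ts).
  - exact: (nestedP _ nc).
move=> u; rewrite !inE => /orP[/eqP ->|/h[u0 ut]]; last first.
  by split=> //; apply: subset_trans ts.
by split; rewrite -?card_gt0 ?cts.
Qed.

End Nested.

Section Subdivision.
Variable T : finType.
Variables (le : rel T) (le' : rel {set T}).
Hypotheses (tot : total_order le) (tot' : total_order le').
Implicit Types (s t : {set T}) (c : chain T) (K : {set {set T}}).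

(** Subdivision of augmented chains. The recursion starts at the empty simplex instead of the
    vertices, so that it commutes with [bdry] in every degree; [n] is fuel, set to [#|s|] in
    [sub]. *)
Fixpoint sub_rec (n : nat) (s : {set T}) : chain {set T} :=
  if n is n'.+1 then wedge le' s (linext (sub_rec n') (bdry le (basis s)))
  else basis set0.

Definition sub : chain T -> chain {set T} := linext (fun s => sub_rec #|s| s).
HB.instance Definition _ := GRing.Additive.on sub.

Lemma sub_set0 : sub (basis set0) = basis set0.
Proof. by rewrite /sub linext_basis cards0. Qed.

Lemma sub_basis s : s != set0 ->
  sub (basis s) = wedge le' s (sub (bdry le (basis s))).
Proof.
rewrite /sub linext_basis -card_gt0; case e : #|s| => [//|n] _ /=; congr wedge.
apply: additive_ext_on (@bdry_basis_on _ le tot s) => t; rewrite inE => /andP[_ ts].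
by rewrite /= !linext_basis; move: ts; rewrite e eqSS => /eqP <-.
Qed.

Lemma sdE q K c : on (layer K q.+1) c -> sd le le' q c = sub c.
Proof.
suff h : forall s, #|s| = q.+1 -> sd_simplex le le' q s = sub (basis s).
  have F : linext (sd_simplex le le' q) = sd le le' q by [].
  rewrite -F; apply: additive_ext_on => s; rewrite inE => /andP[_ /eqP /h].
  by rewrite /= linext_basis.
elim: q => [|q IH] s sq.
  rewrite /= sub_basis -?card_gt0 ?sq //.
  have /eqP/cards1P[x ->] : #|s| = 1%N by [].
  rewrite bdry_vertex sub_set0 wedge_basis inE setU0.
  rewrite (_ : below le' _ set0 = 0%N) ?mulr1z //.
  by apply/eqP; rewrite cards_eq0; apply/eqP/setP => y; rewrite !inE.
rewrite sub_basis -?card_gt0 ?sq //.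
rewrite -[LHS]/(cone le' s (linext (sd_simplex le le' q) (boundary le q.+1 (basis s)))).
rewrite coneE // boundaryE //; congr wedge.
apply: additive_ext_on (@bdry_basis_on _ le tot s) => t; rewrite inE => /andP[_ ts].
by rewrite /= linext_basis; apply: IH; move: ts; rewrite sq eqSS => /eqP.
Qed.

(** The boundary of the cone over the subdivided boundary leaves an error term, the cone over
    [bdry le' (sub (bdry le (basis s)))]; by induction it is a cone over the subdivision of a double
    boundary, hence 0. *)
Lemma sub_bdry c : bdry le' (sub c) = sub (bdry le c).
Proof.
pose F : {additive chain T -> chain {set T}} := bdry le' \o sub.
pose G : {additive chain T -> chain {set T}} := sub \o bdry le.
suff FG : F =1 G by exact: (FG c).
apply: (facet_ext tot) => [|s s0]; rewrite /F /G /=.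
  by rewrite sub_set0 !bdry_set0 raddf0.
move=> h; rewrite sub_basis // bdry_wedge // h bdry_bdry // !raddf0.
by rewrite addr0.
Qed.

(** Sending each barycentre to a vertex of its simplex inverts subdivision on the left: a simplex is
    the wedge of any of its vertices with its own boundary, by [bdry_wedge]. *)
Lemma sub_retract (r : {set T} -> T) : (forall s, s != set0 -> r s \in s) ->
  forall c, simplicial_chain_map le' le r (sub c) = c.
Proof.
move=> hr c; pose F : {additive chain T -> chain T} := simplicial_chain_map le' le r \o sub.
suff FG : F =1 idfun by exact: (FG c).
apply: (facet_ext tot) => [|s s0]; rewrite /F /=.
  by rewrite sub_set0 smap_set0.
move=> h; rewrite sub_basis // smap_wedge // h.
have := bdry_wedge tot (r s) (basis s); rewrite wedge_basis hr // raddf0.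
by move=> /esym/eqP; rewrite subr_eq0 => /eqP <-.
Qed.

Lemma sub_inj (x0 : T) c : sub c = 0 -> c = 0.
Proof.
move=> h; rewrite -[c](@sub_retract (fun s => odflt x0 [pick x in s])) ?h ?raddf0 //.
by move=> s /set0Pn[x xs]; case: pickP => [//|/(_ x)]; rewrite xs.
Qed.

Lemma sub_basis_on s : on [set c | flag c s] (sub (basis s)).
Proof.
have [n] := ubnP #|s|; elim: n s => // n IH s; rewrite ltnS => sn.
have [->|s0] := eqVneq s set0.
  rewrite sub_set0; apply: on_basis; rewrite inE; apply/flagP.
  by rewrite !cards0; split=> //; [apply/nestedP => ? ?; rewrite inE | move=> ?; rewrite inE].
rewrite sub_basis //.
suff : on [set c | (flag (s |: c) s) && (s \notin c)] (sub (bdry le (basis s))).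
  apply: on_additive => c; rewrite inE => /andP[fc sc] /=.
  by rewrite wedge_basis (negbTE sc); apply: onMz; apply: on_basis; rewrite inE.
apply: on_additive (@bdry_basis_on _ le tot s) => t; rewrite inE => ft.
apply: onS (IH t _); last by case/andP: ft => _ /eqP <-.
by apply/subsetP => c; rewrite !inE => /(flag_setU1 ft)[-> ->].
Qed.

(** Peeling off the top simplex, exactly one facet carries the remaining flag, so a single product
    of signs contributes. *)
Lemma sub_coef (c : {set {set T}}) s : flag c s -> sub (basis s) c * sub (basis s) c = 1.
Proof.
have [n] := ubnP #|s|; elim: n s c => // n IH s c; rewrite ltnS => sn fc.
have [s0|s0] := eqVneq s set0.
  move: fc; rewrite s0 => /flagP[]; rewrite cards0 => /cards0_eq -> _ _.
  by rewrite sub_set0 basisE eqxx.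
rewrite sub_basis // wedgeE // flag_top //.
rewrite mulrACA sqr_sign mulr1 additiveE sum_ffunE.
have [t ts ft] := flag_facet fc s0; rewrite (bigD1 t) //= big1 => [|u ut].
  rewrite addr0 ffunMzE mulrACA bdry_coef_facet // mulr1.
  by apply: IH => //; case/andP: ts => _ /eqP <-.
rewrite ffunMzE sub_basis_on ?mul0r // inE; apply: contra ut => fu.
by apply/eqP; exact: flag_inj fu ft.
Qed.

Lemma Bd_closed K : closed_sub (Bd K).
Proof.
move=> c d; rewrite !inE => /andP[cK nc] dc; rewrite (subset_trans dc cK) /=.
exact: (nested_sub dc nc).
Qed.

Lemma sub_on K n c : closed_sub K -> on (layer K n) c -> on (layer (Bd K) n) (sub c).
Proof.
move=> cl; apply: on_additive => s; rewrite inE => /andP[sK /eqP sn].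
apply: onS (@sub_basis_on s); apply/subsetP => d; rewrite !inE => /flagP[-> nd h].
rewrite sn eqxx andbT; apply/andP; split=> //; apply/subsetP => t /h[t0 ts].
by rewrite !inE t0 (cl _ _ sK ts).
Qed.

Lemma Bd_bounded n K : bounded n K -> bounded n (Bd K).
Proof.
move=> b c; rewrite inE => /andP[/subsetP cK nc]; apply: nested_card_le => // s /cK.
by rewrite !inE card_gt0 => /andP[-> /b].
Qed.

Lemma Bd_top n K (c : {set {set T}}) : bounded n K -> (0 < n)%N -> c \in layer (Bd K) n ->
  exists2 s, s \in layer K n & flag c s.
Proof.
move=> b n0; rewrite !inE => /andP[/andP[/subsetP cK nc] /eqP cn].
have h : {in c, forall s, 0 < #|s| <= n}%N.
  by move=> s /cK; rewrite !inE card_gt0 => /andP[-> /b].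
have [t [tc tn sub]] := nested_top nc h cn n0; exists t.
  by rewrite inE tn eqxx andbT; have := cK _ tc; rewrite !inE => /andP[].
apply/flagP; split=> [||u uc] //; first by rewrite cn.
by rewrite -card_gt0 sub //; have /andP[] := h u uc.
Qed.

(** A flag of maximal length lies over a single top simplex, so coefficients never add up. This
    makes the subdivided fundamental cycle an orientation. *)
Lemma sub_unit n K c : bounded n K -> (0 < n)%N ->
  on (layer K n) c -> (forall s, s \in layer K n -> c s * c s = 1) ->
  forall d, d \in layer (Bd K) n -> sub c d * sub c d = 1.
Proof.
move=> b n0 onc c1 d dB; have [s sK fd] := Bd_top b n0 dB.
rewrite additiveE sum_ffunE (bigD1 s) //= big1 => [|t ts].
  by rewrite addr0 ffunMzE mulrACA sub_coef // c1.
rewrite ffunMzE sub_basis_on ?mul0r // inE; apply: contra ts => ft.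
by apply/eqP; exact: flag_inj ft fd.
Qed.

End Subdivision.

(** Injectivity preserves dimensions, so that [g] sends a basis simplex to its image up to sign and
    cones to cones. *)
Lemma sub_natural (T U : finType) (leT : rel T) (leT' : rel {set T})
    (leU : rel U) (leU' : rel {set U}) (g : T -> U) :
  total_order leT -> total_order leT' -> total_order leU -> total_order leU' ->
  injective g -> forall c,
  simplicial_chain_map leT' leU' (fun s => g @: s) (sub leT leT' c) =
  sub leU leU' (simplicial_chain_map leT leU g c).
Proof.
move=> tT tT' tU tU' inj c.
pose F : {additive chain T -> chain {set U}} :=
  simplicial_chain_map leT' leU' (fun s => g @: s) \o sub leT leT'.
pose G : {additive chain T -> chain {set U}} :=
  sub leU leU' \o simplicial_chain_map leT leU g.
suff FG : F =1 G by exact: (FG c).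
apply: (facet_ext tT) => [|s s0]; rewrite /F /G /=.
  by rewrite sub_set0 // !smap_set0 // sub_set0.
move=> h; rewrite sub_basis // smap_wedge // h smap_bdry //.
have [|e _ ->] := @smap_inj _ _ leT leU tU g s; first by move=> ? ? _ _ /inj.
have gs0 : g @: s != set0 by rewrite -card_gt0 card_imset // card_gt0.
by rewrite !raddfMz /= sub_basis.
Qed.

(** * Top-dimensional cycles of a subdivision *)

Section TopCycles.
Variable T : finType.
Variables (le : rel T) (le' : rel {set T}).
Hypotheses (tot : total_order le) (tot' : total_order le').
Implicit Types (s t : {set T}) (K : {set {set T}}).

Lemma on1E (U : finType) (s : {set U}) (c : chain U) : on [set s] c -> c = basis s *~ c s.
Proof. by move=> /onE {1}->; rewrite big_set1. Qed.

(** [wedge le' s] after [contr le' s] projects onto the flags containing [s], and a full flag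
    contains exactly one simplex of cardinality [n]. *)
Lemma flag_decomposition n K (c : chain {set T}) : bounded n K -> (0 < n)%N ->
  on (layer (Bd K) n) c ->
  c = \sum_(s in layer K n) wedge le' s (contr le' s c).
Proof.
move=> b n0.
pose F (s : {set T}) : {additive chain {set T} -> chain {set T}} :=
  wedge le' s \o contr le' s.
move=> onc; rewrite {1}(onE onc).
under [in RHS]eq_bigr => s _ do rewrite -[wedge _ _ _]/(F s c) {1}(onE onc) raddf_sum.
rewrite exchange_big /=; apply: eq_bigr => d dB.
under eq_bigr => s _ do rewrite !raddfMz /= wedge_contr_basis //.
have [s sK fd] := Bd_top b n0 dB; move: (sK); rewrite inE => /andP[_ /eqP sn].
rewrite (bigD1 s) //= (flag_top fd) -?card_gt0 ?sn // big1 ?addr0 // => t /andP[tK ts].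
case: (boolP (t \in d)) => [td|_]; last by rewrite mul0rz.
case/eqP: ts; have [_ nd _] := flagP _ _ fd.
move: tK; rewrite inE => /andP[_ /eqP tn].
by apply: (nested_card_eq nd td); rewrite ?(flag_top fd) -?card_gt0 ?sn ?tn.
Qed.

(** Since [s] has maximal cardinality, the other members of a flag through [s] are proper faces of
    [s]. *)
Lemma contr_on n K (c : chain {set T}) s : bounded n.+1 K -> #|s| = n.+1 ->
  on (layer (Bd K) n.+1) c ->
  on (layer (Bd [set t : {set T} | t \proper s]) n) (contr le' s c).
Proof.
move=> b sn; apply: on_additive => d dB /=; rewrite contr_basis; case: ifP => sd; last exact: on0.
apply: onMz; apply: on_basis; move: dB; rewrite !inE => /andP[/andP[/subsetP dK nd] /eqP dn].
rewrite (_ : #|d :\ s| = n) ?eqxx ?andbT; last by move: dn; rewrite (cardsD1 s) sd => -[].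
apply/andP; split; last exact: nested_sub (subD1set d s) nd.
apply/subsetP => t; rewrite !inE => /andP[ts td].
have /andP[-> /b tb] : (t != set0) && (t \in K) by have := dK _ td; rewrite !inE.
rewrite properEneq ts /=; case/orP: (nestedP _ nd _ _ sd td) => // st.
by case/negP: ts; rewrite eq_sym eqEcard st sn.
Qed.

Lemma sub_assemble n K (c : chain {set T}) : bounded n K -> (0 < n)%N ->
  on (layer (Bd K) n) c ->
  (forall s, s \in layer K n -> exists a : int,
     wedge le' s (contr le' s c) = sub le le' (basis s) *~ a) ->
  exists2 c', on (layer K n) c' & c = sub le le' c'.
Proof.
move=> b n0 onc h.
have /fin_all_exists[a ha] : forall s, exists a : int, s \in layer K n ->
    wedge le' s (contr le' s c) = sub le le' (basis s) *~ a.
  by move=> s; case: (boolP (s \in layer K n)) => [/h[a e]|_]; [exists a | exists 0].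
exists (\sum_(s in layer K n) basis s *~ a s).
  by apply: on_sum => s sK; apply: onMz; apply: on_basis.
rewrite [LHS](flag_decomposition b n0 onc) raddf_sum.
by apply: eq_bigr => s /ha ->; rewrite raddfMz.
Qed.

(* A cycle of full flags is the subdivision of a chain.  Removing the top
   simplex s from the flags leaves a cycle in the subdivided boundary of s,
   which is by induction the subdivision of a multiple of the boundary of s. *)
Lemma sub_surj n K (c : chain {set T}) : bounded n.+1 K -> on (layer (Bd K) n.+1) c ->
  (n != 0 -> bdry le' c = 0) ->
  exists2 c', on (layer K n.+1) c' & c = sub le le' c'.
Proof.
elim: n K c => [|n IH] K c b onc cyc; apply: (sub_assemble b _ onc) => // s sK;
  move: (sK); rewrite inE => /andP[_ /eqP sn]; have onC := contr_on b sn onc.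
  have /on1E -> : on [set set0] (contr le' s c).
    by apply: onS onC; apply/subsetP => d; rewrite !inE => /andP[_]; rewrite cards_eq0.
  exists (contr le' s c set0); rewrite raddfMz /= sub_basis -?card_gt0 ?sn //.
  by have /eqP/cards1P[x ->] := sn; rewrite bdry_vertex sub_set0.
have [||c1 onc1 e] := IH [set t : {set T} | t \proper s] (contr le' s c) _ onC.
- by move=> t; rewrite inE -ltnS -sn => /proper_card.
- by rewrite bdry_contr // cyc // raddf0 oppr0.
have s0 : s != set0 by rewrite -card_gt0 sn.
have /set0Pn[x xs] := s0.
have cyc1 : bdry le c1 = 0.
  apply: (sub_inj tot tot' x); rewrite -sub_bdry // -e bdry_contr // cyc //.
  by rewrite raddf0 oppr0.
(* The cycle [c1] bounds its cone from [x]. That cone consists of subsets of [s] with as many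
   elements as [s], so it is a multiple of [s] and [c1] is the same multiple of its boundary. *)
have e1 : bdry le (wedge le x c1) = c1 by rewrite bdry_wedge // cyc1 raddf0 subr0.
have /on1E ew : on [set s] (wedge le x c1).
  apply: on_additive onc1 => u; rewrite !inE => /andP[us /eqP un] /=.
  rewrite wedge_basis; case: ifP => xu; first exact: on0.
  apply: onMz; apply: on_basis; rewrite inE eqEcard subUset sub1set xs proper_sub //=.
  by rewrite cardsU1 xu un sn.
exists (wedge le x c1 s); by rewrite e -e1 {1}ew !raddfMz /= -sub_basis // e1.
Qed.

End TopCycles.

(** * Perfect acyclic matchings and the trace formula *)

Section Morse.
Variable T : finType.
Variable le : rel T.
Hypothesis tot : total_order le.
Implicit Types (s t : {set T}) (c w z : chain T) (K L : {set {set T}}).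

(* A perfect acyclic matching of L: [lo] marks the smaller element of a pair,
   [mu] is the partner, and [rho] certifies acyclicity. *)
Record matching L (lo : {set T} -> bool) (mu : {set T} -> {set T})
    (rho : {set T} -> nat) : Prop := Matching {
  matching_in : {in L, forall s, mu s \in L};
  matchingK : {in L, forall s, mu (mu s) = s};
  matching_lo : {in L, forall s, lo (mu s) = ~~ lo s};
  matching_facet : {in L, forall s, lo s -> is_facet s (mu s)};
  matching_rho : {in L &, forall s t, lo s -> lo t ->
     is_facet t (mu s) -> t != s -> (rho t < rho s)%N} }.

Lemma bdryE c t : bdry le c t = \sum_s bdry le (basis s) t * c s.
Proof. by rewrite additiveE sum_ffunE; apply: eq_bigr => s _; rewrite ffunMzE. Qed.

Lemma bdry_coef0 s t : ~~ is_facet t s -> bdry le (basis s) t = 0.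
Proof. by move=> h; rewrite (bdry_basis_on tot) // inE. Qed.

(** Induction on a strict bound [N] for the ranks of the lower simplices in the support of [c]. *)
Lemma matching_acyclic L lo mu rho N q c : matching L lo mu rho ->
  (forall s t, s \in L -> is_facet t s -> t \in L) ->
  on (layer L q) c -> bdry le c = 0 ->
  (forall s, lo s -> c s != 0 -> (rho s < N)%N) ->
  exists2 w, on (layer L q.+1) w & bdry le w = c.
Proof.
move=> M cl; elim: N c => [|N IH] c onc cyc ub.
  exists 0; first exact: on0.
  rewrite raddf0; apply/ffunP => s0; rewrite ffunE; apply/esym/eqP.
  have inL s : c s != 0 -> s \in L.
    by move=> /(on_mem onc); rewrite inE => /andP[].
  case: (boolP (c s0 == 0)) => // cs0.
  (* Only upper simplices remain. For one whose partner has maximal rank, acyclicity keeps that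
     partner out of the boundary of all the others, so it survives in the boundary of [c]: a
     contradiction. *)
  case: (@arg_maxnP _ s0 (fun s => c s != 0) (fun s => rho (mu s)) cs0) => s cs smax.
  have los : lo s = false by apply/negP => /ub/(_ cs).
  have sL := inL s cs.
  have lom : lo (mu s) by rewrite (matching_lo M) ?los.
  have fm : is_facet (mu s) s.
    have := matching_facet M (matching_in M sL) lom; by rewrite (matchingK M).
  have : bdry le c (mu s) = 0 by rewrite cyc ffunE.
  rewrite bdryE (bigD1 s) //= big1 => [|u us].
    rewrite addr0 => /eqP; rewrite mulf_eq0 (negbTE cs) orbF => /eqP e.
    by have := bdry_coef_facet tot fm; rewrite e mul0r.
  have [->|cu] := eqVneq (c u) 0; first by rewrite mulr0.
  case: (boolP (is_facet (mu s) u)) => [fu|/bdry_coef0 ->]; last by rewrite mul0r.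
  have uL := inL u cu; have lou : lo u = false by apply/negP => /ub/(_ cu).
  have lomu : lo (mu u) by rewrite (matching_lo M) ?lou.
  have := smax u cu; rewrite /= leqNgt (matching_rho M) ?(matching_in M) ?(matchingK M) //.
  by apply: contra us => /eqP /(congr1 mu); rewrite !(matchingK M) // => ->.
(* Each lower simplex of rank [N] is cancelled by the boundary of its partner, with the sign [D s]
   of square 1. The other lower simplices that this brings in have smaller rank. *)
pose D s : int := bdry le (basis (mu s)) s.
pose w := \sum_(s in L | lo s && (rho s == N)) basis (mu s) *~ (c s * D s).
have onw : on (layer L q.+1) w.
  apply: on_sum => s /and3P[sL los _]; have [->|cs] := eqVneq (c s) 0.
    by rewrite mul0r; exact: on0.
  apply: onMz; apply: on_basis; rewrite inE (matching_in M) //=.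
  have := on_mem onc cs; rewrite inE => /andP[_ /eqP <-].
  by have /andP[] := matching_facet M sL los.
have [|||w' onw' e] := IH (c - bdry le w).
- apply: onD => //; apply: onN; apply: on_additive onw => s.
  rewrite inE => /andP[sL /eqP sq]; apply: onS (@bdry_basis_on _ _ tot s).
  apply/subsetP => t; rewrite !inE => ft; rewrite (cl s) //=.
  by case/andP: ft => _; rewrite sq eqSS eq_sym.
- by rewrite raddfB /= cyc bdry_bdry // subrr.
- move=> t lot; rewrite !ffunE => ct.
  have bw : bdry le w t =
      \sum_(s in L | lo s && (rho s == N)) bdry le (basis (mu s)) t * (c s * D s).
    rewrite /w raddf_sum sum_ffunE; apply: eq_bigr => s _.
    by rewrite raddfMz ffunMzE.
  have tL : t \in L.
    apply: contraNT ct => tL; rewrite bw (onc t) ?inE ?(negbTE tL) // sub0r oppr_eq0.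
    rewrite big1 // => s /and3P[sL _ _]; rewrite bdry_coef0 ?mul0r //.
    by apply: contra tL; apply: cl; exact: (matching_in M).
  rewrite ltnNge; apply: contraNN ct => Nt; rewrite bw.
  have z s : s \in L -> lo s -> rho s = N -> s != t ->
      bdry le (basis (mu s)) t * (c s * D s) = 0.
    move=> sL los rs st; rewrite bdry_coef0 ?mul0r //; apply/negP => ft.
    have := matching_rho M sL tL los lot ft; rewrite rs ltnNge Nt eq_sym => /(_ st).
    by [].
  have [rt|rt] := eqVneq (rho t) N.
    rewrite (bigD1 t) /= ?tL ?lot ?rt ?eqxx // big1 ?addr0.
      rewrite mulrCA /D bdry_coef_facet ?mulr1 ?subrr //; exact: (matching_facet M).
    by move=> s /andP[/and3P[sL los /eqP rs] st]; apply: z.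
  rewrite big1 ?subr0 => [|s /and3P[sL los /eqP rs]].
    have [//|/(ub _ lot)] := eqVneq (c t) 0.
    by rewrite ltnS leqNgt ltn_neqAle eq_sym rt Nt.
  by apply: z => //; apply: contra rt => /eqP <-; rewrite rs.
by exists (w + w'); [apply: onD | rewrite raddfD /= e addrC subrK].
Qed.

(** The last clause leaves only [s] and [t] to contribute to the boundary of a top chain at the
    common facet [u]. *)
Definition adjacent n K : rel {set T} := [rel s t | [&& s \in layer K n, t \in layer K n &
  [exists u, [&& is_facet u s, is_facet u t &
     [forall v in layer K n, (u \subset v) ==> ((v == s) || (v == t))]]]]].

(** Here [n] is the dimension plus 1, so that it is additive under joins; the empty simplex is
    matched like any other unless it is itself the top simplex, in the case [n = 0]. *)
Record morse_sphere n K : Prop := MorseSphere {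
  ms_closed : closed_sub K;
  ms_set0 : set0 \in K;
  ms_bounded : bounded n K;
  ms_matching : exists s lo mu rho, s \in layer K n /\ matching (K :\ s) lo mu rho;
  ms_connect : {in layer K n &, forall s t, connect (adjacent n K) s t} }.

Lemma adjacent_sqr n K z s t : on (layer K n) z -> bdry le z = 0 ->
  adjacent n K s t -> z s * z s = z t * z t.
Proof.
move=> onz cyc /= /and3P[sK tK /existsP[u /and3P[us ut /forall_inP h]]].
have [->//|st] := eqVneq s t.
have : bdry le z u = 0 by rewrite cyc ffunE.
rewrite bdryE (bigD1 s) // (bigD1 t) ?(eq_sym t) //= big1 ?addr0.
  have := bdry_coef_facet tot us; have := bdry_coef_facet tot ut.
  move: (bdry _ _ _) (bdry _ _ _) (z s) (z t) => a b x y ha hb e.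
  have e1 : a * x = - (b * y) by apply/eqP; rewrite -addr_eq0 e.
  rewrite -[x * x]mul1r -hb -[y * y]mul1r -ha mulrACA e1 mulrNN; ring.
move=> v /andP[vs vt]; have [->|zv] := eqVneq (z v) 0; first by rewrite mulr0.
rewrite bdry_coef0 ?mul0r //; apply: contra vs => /andP[uv _].
by have := h v (on_mem onz zv); rewrite uv (negbTE vt) orbF.
Qed.

(* The conclusion says that K has the reduced homology of a sphere with
   fundamental cycle z. *)
Lemma fundamental_cycle n K : (0 < n)%N -> morse_sphere n K ->
  exists z, [/\ on (layer K n) z, bdry le z = 0,
    forall s, s \in layer K n -> z s * z s = 1 &
    forall q c, on (layer K q) c -> bdry le c = 0 ->
      exists w (a : int), [/\ on (layer K q.+1) w, c = bdry le w + z *~ a & q != n -> a = 0]].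
Proof.
case: n => // n _ [cl K0 b [s [lo [mu [rho [sK M]]]]] conn].
have [sK1 /eqP sn] : s \in K /\ #|s| == n.+1 by move: sK; rewrite inE => /andP[].
have clL : forall u t, u \in K :\ s -> is_facet t u -> t \in K :\ s.
  move=> u t; rewrite !inE => /andP[us uK] /andP[tu /eqP ut].
  rewrite (cl u) // andbT; apply/eqP => e; move: (b u uK); by rewrite ut e sn ltnn.
have acyc q c : on (layer (K :\ s) q) c -> bdry le c = 0 ->
    exists2 w, on (layer (K :\ s) q.+1) w & bdry le w = c.
  move=> onc cyc; apply: (matching_acyclic (N := (\max_t rho t).+1) M clL onc cyc).
  by move=> t _ _; rewrite ltnS; exact: leq_bigmax.
have LK q : layer (K :\ s) q \subset layer K q.
  by apply/subsetP => t; rewrite !inE => /andP[/andP[_ ->] ->].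
(* The boundary of the critical simplex [s] also bounds a chain avoiding [s]; the difference is a
   cycle with coefficient 1 at [s]. *)
have [||w onw e] := acyc n (bdry le (basis s)).
- apply: onS (@bdry_basis_on _ _ tot s); apply/subsetP => t; rewrite !inE => /andP[ts /eqP et].
  rewrite (cl s) // andbT -eqSS -et sn eqxx andbT; apply/eqP => e.
  by move: et; rewrite e => /n_Sn.
- exact: bdry_bdry.
have [z Ez] : exists z, z = basis s - w by exists (basis s - w).
have onz : on (layer K n.+1) z.
  by rewrite Ez; apply: onD; [exact: on_basis | apply: onN; exact: onS onw].
have cyc : bdry le z = 0 by rewrite Ez raddfB /= e subrr.
have ws : w s = 0 by apply: onw; rewrite !inE eqxx.
have zs : z s = 1 by rewrite Ez !ffunE ws eqxx subr0.
exists z; split=> //.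
  move=> t tK; have /connectP[p pth ->] := conn _ _ sK tK.
  suff H u : path (adjacent n.+1 K) u p -> z (last u p) * z (last u p) = z u * z u.
    by rewrite H // zs mulr1.
  elim: p u {pth} => //= v p IH u /andP[uv /IH ->].
  exact/esym/(adjacent_sqr onz cyc uv).
move=> q c onc cc; have [eq|nq] := eqVneq q n.+1; last first.
  have [||w' onw' e'] := acyc q c => //.
    move=> t; rewrite !inE; case: (eqVneq t s) => [-> _|ts] /=; last first.
      by move=> h; apply: onc; rewrite inE.
    by apply: onc; rewrite inE sn eq_sym (negbTE nq) andbF.
  by exists w', 0; split=> //; [exact: onS onw' | rewrite e' addr0].
(* In top degree, [c - z *~ c s] is a cycle avoiding [s]; it bounds a chain one degree higher, where
   there are no simplices. *)
rewrite {}eq in onc *; exists 0, (c s); split=> //; first exact: on0.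
rewrite raddf0 add0r; apply/eqP; rewrite -subr_eq0; apply/eqP.
have [||w' onw' <-] := acyc n.+1 (c - z *~ c s).
- move=> t; rewrite !inE negb_and; case: (eqVneq t s) => [-> _|ts] /=.
    by rewrite !ffunE ffunMzE zs mul1r subrr.
  move=> h; have tn : t \notin layer K n.+1 by rewrite inE negb_and.
  by rewrite !ffunE ffunMzE (onc t tn) (onz t tn) mul0r subr0.
- by rewrite raddfB raddfMz /= cc cyc mul0rz subr0.
rewrite (_ : w' = 0) ?raddf0 //; apply/ffunP => t; rewrite ffunE.
apply: onw'; rewrite !inE; apply/negP => /andP[/andP[_ /b tb] /eqP te].
by rewrite te ltnn in tb.
Qed.

(** * The Hopf trace formula *)

Section Trace.
Variables (n : nat) (K : {set {set T}}) (z : chain T).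
Hypotheses (cl : closed_sub K) (b : bounded n K).
Hypotheses (onz : on (layer K n) z) (cycz : bdry le z = 0) (z0 : z != 0).
Hypothesis hom : forall q c, on (layer K q) c -> bdry le c = 0 ->
  exists w (a : int), [/\ on (layer K q.+1) w, c = bdry le w + z *~ a & q != n -> a = 0].

Lemma on_linext (A : {set {set T}}) (h : {set T} -> chain T) (B : {set {set T}}) c :
  (forall s, s \in A -> on B (h s)) -> on A c -> on B (linext h c).
Proof.
by move=> hB; apply: (@on_additive _ _ _ _ (linext h)) => s sA; rewrite /= linext_basis; apply: hB.
Qed.

(** A chain homotopy from the identity to a projection onto the multiples of [z], built by induction
    on the cardinality: [basis s] minus the homotopy applied to its boundary is a cycle, and [hom]
    decomposes it. *)
Lemma contraction : exists (h : {set T} -> chain T) (lam : {set T} -> int),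
  forall s, s \in K -> [/\ on (layer K #|s|.+1) (h s),
    basis s = bdry le (h s) + linext h (bdry le (basis s)) + z *~ lam s &
    #|s| != n -> lam s = 0].
Proof.
suff H q : exists (h : {set T} -> chain T) (lam : {set T} -> int),
  forall s, s \in K -> (#|s| < q)%N -> [/\ on (layer K #|s|.+1) (h s),
    basis s = bdry le (h s) + linext h (bdry le (basis s)) + z *~ lam s &
    #|s| != n -> lam s = 0].
  have [h [lam hh]] := H n.+1; exists h, lam => s sK; apply: hh => //.
  by rewrite ltnS; exact: b.
elim: q => [|q [h [lam IH]]]; first by exists (fun=> 0), (fun=> 0).
have step s : exists wa : chain T * int, s \in K -> #|s| = q ->
    [/\ on (layer K #|s|.+1) wa.1,
        basis s = bdry le wa.1 + linext h (bdry le (basis s)) + z *~ wa.2 &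
        #|s| != n -> wa.2 = 0].
  case: (boolP ((s \in K) && (#|s| == q))) => [/andP[sK /eqP sq]|no]; last first.
    by exists (0, 0) => sK sq; rewrite sK sq eqxx in no.
  have onb := @bdry_basis_on _ _ tot s; set c := bdry le (basis s) in onb *.
  have facet t : t \in [set t | is_facet t s] -> t \in K /\ #|t|.+1 = q.
    by rewrite inE => /andP[ts /eqP <-]; split; [exact: cl ts | ].
  have tq t : #|t|.+1 = q -> (#|t| < q)%N /\ #|t| != n.
    by move=> tq; have := b sK; rewrite sq -tq ltnS leqnn neq_ltn => ->.
  have onh : on (layer K q) (linext h c).
    apply: on_linext onb => t /facet[tK e]; have [tl _] := tq t e.
    by have [h1 _ _] := IH t tK tl; rewrite -e.
  have cyc : bdry le (basis s - linext h c) = 0.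
    rewrite raddfB /= -/c; apply/eqP; rewrite subr_eq0; apply/eqP.
    (* On facets of [s] the formula holds without the [lam] term, their cardinality being less than
       [n]. *)
    pose F : {additive chain T -> chain T} := (bdry le \o linext h) \+ (linext h \o bdry le).
    have Fc : F c = c.
      apply: (additive_ext_on (G := idfun) _ onb) => t /facet[tK e]; have [tl tn] := tq t e.
      have [_ e2 /(_ tn) lt] := IH t tK tl.
      by rewrite [RHS]/= {2}e2 lt mulr0z addr0 /F /= linext_basis.
    have bc : bdry le c = 0 by exact: bdry_bdry.
    by rewrite -[LHS]Fc /F /= bc raddf0 addr0.
  have onc : on (layer K q) (basis s - linext h c).
    by apply: onD; [apply: on_basis; rewrite inE sK sq eqxx | apply: onN].
  have [w [a [onw e an]]] := hom onc cyc; exists (w, a) => _ _; rewrite sq.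
  by split=> //=; rewrite addrAC -e subrK.
have /fin_all_exists[wa hwa] := step.
pose h' s := if #|s| == q then (wa s).1 else h s.
exists h', (fun s => if #|s| == q then (wa s).2 else lam s) => s sK; rewrite ltnS => sq.
have -> : linext h' (bdry le (basis s)) = linext h (bdry le (basis s)).
  apply: additive_ext_on (@bdry_basis_on _ _ tot s) => t; rewrite inE => /andP[_ /eqP ts].
  by rewrite /= !linext_basis /h' ifN // neq_ltn -ts sq.
rewrite /h'; case: eqP => [/(hwa s sK)|/eqP ns] //.
by apply: IH => //; rewrite ltn_neqAle ns.
Qed.

(* Hopf trace formula: writing a basis element as
   bdry h + h bdry + lam z, the first two contributions to the supertrace
   cancel because F commutes with bdry. *)
Lemma supertrace (F : {additive chain T -> chain T}) (m : int) :
  (forall c, F (bdry le c) = bdry le (F c)) ->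
  (forall q c, on (layer K q) c -> on (layer K q) (F c)) ->
  F z = z *~ m ->
  \sum_(s in K) (-1) ^+ #|s| * F (basis s) s = (-1) ^+ n * m.
Proof.
move=> Fb Fon Fz; have [h [lam H]] := contraction.
pose G : {additive chain T -> chain T} := F \o linext h.
have onG s : s \in K -> on (layer K #|s|.+1) (F (h s)).
  by move=> /H[h1 _ _]; apply: Fon.
have inK s t : t \in K -> bdry le (basis t) s != 0 -> s \in K /\ #|t| = #|s|.+1.
  move=> tK; have [|/bdry_coef0 ->] := boolP (is_facet s t); last by rewrite eqxx.
  by case/andP => st /eqP tc _; rewrite tc (cl tK st).
have e s : s \in K -> (-1) ^+ #|s| * F (basis s) s =
    \sum_(t in K) (-1) ^+ #|s| * (bdry le (basis t) s * F (h s) t)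
  + \sum_(t in K) (-1) ^+ #|s| * (F (h t) s * bdry le (basis s) t)
  + (-1) ^+ n * m * (z s * lam s).
  move=> sK; have [_ {1}-> ln] := H s sK; rewrite !raddfD !ffunE !mulrDr.
  congr (_ + _ + _).
  - rewrite Fb bdryE mulr_sumr [RHS]big_mkcond; apply: eq_bigr => t _.
    case: ifP => // tK; rewrite (onG s sK) ?mulr0 // inE tK.
    by [].
  - rewrite -[F (linext _ _)]/(G _) additiveE sum_ffunE mulr_sumr [RHS]big_mkcond.
    apply: eq_bigr => t _; rewrite ffunMzE /G /= linext_basis; case: ifP => // tK.
    have [->|/(inK _ _ sK)[]] := eqVneq (bdry le (basis s) t) 0; first by rewrite !mulr0.
    by rewrite tK.
  - rewrite raddfMz /= Fz !ffunMzE; have [<-|/ln ->] := eqVneq #|s| n; first by ring.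
    by rewrite !mulr0.
rewrite (eq_bigr _ e) !big_split /= -mulr_sumr.
(* After the exchange the two sums match term by term, with opposite signs because [s] is a facet of
   [t]. *)
rewrite [X in _ + X + _]exchange_big -big_split /=.
(* Apply the decomposition to [z] itself: its boundary is 0 and the homotopy sends it above the top
   degree, so only the [lam] term remains. *)
have lz : \sum_(s in K) z s * lam s = 1.
  have onK : on K z by apply: onS onz; apply/subsetP => s; rewrite inE => /andP[].
  pose P : {additive chain T -> chain T} :=
    (bdry le \o linext h) \+ (linext h \o bdry le) \+ linext (fun s => z *~ lam s).
  have eP : z = P z.
    apply: (additive_ext_on (F := idfun) _ onK) => s /H[_ e1 _].
    by rewrite [LHS]e1 /P /= !linext_basis.
  have h0 : linext h z = 0.
    have onh : on (layer K n.+1) (linext h z).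
      apply: on_linext onz => s; rewrite inE => /andP[/H[h1 _ _] /eqP sn].
      by rewrite -sn.
    apply/ffunP => t; rewrite ffunE; apply: onh; rewrite inE.
    by apply/negP => /andP[/b tb /eqP te]; rewrite te ltnn in tb.
  have {eP} : z = z *~ \sum_(s in K) z s * lam s.
    rewrite {1}eP /P /= h0 cycz !raddf0 !add0r /linext (bigID (mem K)) /=.
    rewrite [X in _ + X]big1 ?addr0 => [|s sK]; last by rewrite (onK s sK) mulr0z.
    rewrite mulrz_sumr; apply: eq_bigr => s _; by rewrite mulrzM mulrC.
  have [t zt] : exists t, z t != 0.
    apply/existsP; apply: contraR z0 => /existsPn h1; apply/eqP/ffunP => t.
    by rewrite ffunE; apply/eqP; have := h1 t; rewrite negbK.
  move=> /ffunP/(_ t); rewrite ffunMzE => /esym/eqP.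
  by rewrite -subr_eq0 -{2}[z t]mulr1 -mulrBr mulf_eq0 (negbTE zt) subr_eq0 => /eqP.
rewrite lz mulr1 [X in X + _]big1 ?add0r // => s sK.
rewrite -big_split /= big1 // => t tK.
have [->|/(inK _ _ tK)[_ ->]] := eqVneq (bdry le (basis t) s) 0.
  by rewrite mul0r !mulr0 addr0.
by rewrite exprS; ring.
Qed.
End Trace.
End Morse.

(** * Combinatorial spheres and their joins *)

Section PairsToMatching.
Variable T : finType.
Implicit Types (s t u : {set T}) (K : {set {set T}}) (V W : {set {set T} * {set T}}).

Definition touches s (ab : {set T} * {set T}) : bool := (ab.1 == s) || (ab.2 == s).

(** [W] may contain a pair with lower member ∅ outside [V]. Such a pair takes part in no step
    between distinct lower simplices, so acyclicity of [V] is enough. *)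
Lemma matching_of_pairs K V W sigma :
  (forall ab, ab \in W -> [/\ ab.1 \in K, ab.2 \in K & is_facet ab.1 ab.2]) ->
  (forall s ab cd, ab \in W -> cd \in W -> touches s ab -> touches s cd -> ab = cd) ->
  (forall u, u \in K -> u != sigma -> exists2 ab, ab \in W & touches u ab) ->
  (forall ab, ab \in W -> ~~ touches sigma ab) ->
  (forall ab, ab \in W -> ab.1 != set0 -> ab \in V) ->
  (forall b0 w, b0 \in K -> trajectory V b0 w -> (0 < size w)%N ->
     last b0 (unzip2 w) <> b0) ->
  exists lo mu rho, matching (K :\ sigma) lo mu rho.
Proof.
move=> WK Wuniq Wall Wsig WV acyc.
pose lo s := [exists b, (s, b) \in W].
pose mu s := if [pick b | (s, b) \in W] is Some b then b
             else odflt set0 [pick a | (a, s) \in W].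
have touch1 a b : touches a (a, b) by rewrite /touches eqxx.
have touch2 a b : touches b (a, b) by rewrite /touches eqxx orbT.
have mu1 a b : (a, b) \in W -> mu a = b.
  move=> ab; rewrite /mu; case: pickP => [b' ab'|/(_ b)]; last by rewrite ab.
  by case: (Wuniq a _ _ ab ab' (touch1 _ _) (touch1 _ _)).
have ne a b : (a, b) \in W -> a != b.
  move=> /WK[_ _ /andP[_ /eqP e]]; apply/eqP => E; move: e; rewrite /= E.
  exact: n_Sn.
have lo2 a b : (a, b) \in W -> lo b = false.
  move=> ab; apply/existsP => -[c bc]; case/eqP: (ne _ _ ab).
  by case: (Wuniq b _ _ ab bc (touch2 _ _) (touch1 _ _)) => ->.
have mu2 a b : (a, b) \in W -> mu b = a.
  move=> ab; rewrite /mu; case: pickP => [b' bb'|_].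
    by have /existsP[] := negbT (lo2 _ _ ab); exists b'.
  case: pickP => [a' a'b|/(_ a)] /=; last by rewrite ab.
  by case: (Wuniq b _ _ ab a'b (touch2 _ _) (touch2 _ _)).
have lo1 a b : (a, b) \in W -> lo a by move=> ab; apply/existsP; exists b.
have loW a : lo a -> (a, mu a) \in W by case/existsP => b ab; rewrite (mu1 _ _ ab).
have cases s : s \in K :\ sigma -> exists a b, (a, b) \in W /\ (s = a \/ s = b).
  rewrite !inE => /andP[ss sK]; have [[a b] ab] := Wall s sK ss.
  by case/orP => /eqP /= e; exists a, b; split=> //; [left | right].
have inL a b : (a, b) \in W -> a \in K :\ sigma /\ b \in K :\ sigma.
  move=> ab; have [aK bK _] := WK _ ab; have := Wsig _ ab.
  by rewrite /touches !inE negb_or /= aK bK => /andP[-> ->].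
pose step := [rel s t | [&& lo s, lo t, is_facet t (mu s) & t != s]].
have stepV s t : step s t ->
    [/\ (s, mu s) \in V, (t, mu t) \in V, is_facet t (mu s) & mu s != mu t].
  case/and4P => los lot ft ts; have sW := loW _ los; have tW := loW _ lot.
  have [_ _ /andP[_ /eqP cs]] := WK _ sW; have /andP[_ /eqP ct] := ft.
  have cst : #|s| = #|t| by apply: succn_inj; rewrite -cs -ct.
  have s0 : s != set0.
    apply: contra ts => /eqP s0; rewrite s0 -cards_eq0 -cst s0 cards0 //.
  have t0 : t != set0 by rewrite -card_gt0 -cst card_gt0.
  split; [exact: WV | exact: WV | by [] |].
  apply: contra ts => /eqP e; rewrite -e in tW.
  by case: (Wuniq (mu s) _ _ sW tW (touch2 _ _) (touch2 _ _)) => ->.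
have traj p s : path step s p -> trajectory V (mu s) [seq (x, mu x) | x <- p].
  elim: p s => //= x p IH s /andP[/stepV[_ -> -> ->] /IH ->] //.
have noloop s t : step s t -> ~~ connect step t s.
  move=> st; apply/connectP => -[p pth e].
  have pth2 : path step s (t :: p) by apply/andP; split.
  have [sV _ _ _] := stepV _ _ st.
  have lW : lo s by case/and4P: st.
  have [_ muK _] := WK _ (loW _ lW).
  case: (acyc _ _ muK (traj _ _ pth2)) => //.
  by rewrite /unzip2 -map_comp (last_map mu) /= -e.
(* The rank counts the lower simplices reachable from [s], including [s]; it drops along a step
   because the start cannot be reached again. *)
exists lo, mu, (fun s => #|[set u | connect step s u]|); split.
- by move=> s /cases[a [b [ab [->|->]]]]; rewrite (mu1 _ _ ab, mu2 _ _ ab); case: (inL _ _ ab).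
- by move=> s /cases[a [b [ab [->|->]]]]; rewrite !(mu1 _ _ ab, mu2 _ _ ab).
- by move=> s /cases[a [b [ab [->|->]]]];
    rewrite !(mu1 _ _ ab, mu2 _ _ ab, lo1 _ _ ab, lo2 _ _ ab).
- by move=> s _ /loW/WK[].
move=> s t _ _ los lot ft ts; have st : step s t by rewrite /= los lot ft ts.
apply: proper_card; apply/properP; split.
  by apply/subsetP => u; rewrite !inE; apply: connect_trans; exact: connect1.
by exists s; rewrite !inE ?connect0 // noloop.
Qed.

(** If the field pairs ∅ with a vertex, that vertex is critical by convention and the other critical
    simplex is the unmatched one. Otherwise ∅ is paired with the critical vertex [t], leaving
    [s]. *)
Lemma sphere_matching d K : combinatorial_sphere d K ->
  exists sigma lo mu rho, sigma \in layer K d.+1 /\ matching (K :\ sigma) lo mu rho.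
Proof.
case=> [[K0 cl] pm [V [[[VK Vone] acyc] [s [t [st sd t1 crit]]]]]].
have Vuniq u ab cd : ab \in V -> cd \in V -> touches u ab -> touches u cd -> ab = cd.
  move=> abV cdV uab ucd; have /card_le1_eqP h := Vone u.
  by apply: h; rewrite inE ?abV ?cdV.
have critP u : u \in K -> u != set0 ->
    (forall ab, ab \in V -> ~~ touches u ab) \/ #|u| = 1%N /\ (set0, u) \in V ->
    u = s \/ u = t.
  move=> uK u0 h; suff : u \in critical K V by rewrite crit !inE => /orP[/eqP|/eqP]; auto.
  rewrite inE uK u0 /=; case: h => [h|[-> ->]]; last by rewrite orbT.
  by apply/orP; left; apply/forall_inP => ab /h; rewrite negb_or.
have critV u : u = s \/ u = t -> [/\ u \in K, u != set0 &
    (forall ab, ab \in V -> ~~ touches u ab) \/ #|u| = 1%N /\ (set0, u) \in V].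
  move=> h; have : u \in critical K V by rewrite crit !inE; case: h => ->; rewrite eqxx ?orbT.
  rewrite inE => /and3P[-> -> /orP[/forall_inP h1|/andP[/eqP -> ->]]]; split=> //; last by right.
  by left=> ab /h1; rewrite negb_or.
have [/existsP[w w0]|/existsPn no] := boolP [exists w, (set0, w) \in V].
  have [_ wK /andP[_ /eqP w1]] := VK _ _ w0; rewrite cards0 in w1.
  have wn : w != set0 by rewrite -card_gt0 w1.
  (* The vertex [w] can be [s] only if [d] is 0, and then [t] also has cardinality [d.+1]. *)
  have [sigma [sw sk sdim swst]] : exists sigma, [/\ sigma != w, sigma = s \/ sigma = t,
      #|sigma| = d.+1 & forall u, u = s \/ u = t -> u != sigma -> u = w].
    case: (critP w wK wn (or_intror (conj w1 w0))) => e.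
      exists t; rewrite e eq_sym st t1 -sd -e w1; split; auto.
      by move=> u [|] -> //; rewrite eqxx.
    exists s; rewrite e st; split; auto.
    by move=> u [|] -> //; rewrite eqxx.
  have [sK s0 hs] := critV _ sk.
  have sV ab : ab \in V -> ~~ touches sigma ab.
    case: hs => [|[_ s0V]]; first exact.
    have := Vuniq set0 _ _ w0 s0V; rewrite /touches /= eqxx => /(_ isT isT)[e].
    by rewrite e eqxx in sw.
  have [|||||| lo [mu [rho M]]] := @matching_of_pairs K V V sigma; rewrite //.
  - by case=> a b; exact: VK.
  - move=> u uK us; apply/exists_inP; apply: contraT; rewrite negb_exists_in => /forall_inP h.
    have [u0|u0] := eqVneq u set0.
      by have := h _ w0; rewrite /touches u0 eqxx.
    have e := swst _ (critP u uK u0 (or_introl h)) us.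
    by have := h _ w0; rewrite /touches e eqxx orbT.
  - by exists sigma, lo, mu, rho; split=> //; rewrite inE sK sdim eqxx.
have unm u : u = s \/ u = t -> forall ab, ab \in V -> ~~ touches u ab.
  by move=> /critV[_ _ [//|[_ h]]]; have := no u; rewrite h.
have no0 ab : ab \in V -> ~~ touches set0 ab.
  case: ab => a b ab; rewrite /touches negb_or /=; apply/andP; split.
    by apply: contraTneq ab => ->; exact: no.
  have [_ _ /andP[_ /eqP e]] := VK _ _ ab; by rewrite -card_gt0 e.
have [sK s0 _] := critV s (or_introl erefl).
have [tK t0 _] := critV t (or_intror erefl).
have [|||||| lo [mu [rho M]]] := @matching_of_pairs K V ((set0, t) |: V) s.
- move=> ab /setU1P[->|abV] /=; last by case: ab abV => a b; exact: VK.
  by split=> //; [apply: cl sK _; exact: sub0set | rewrite /is_facet sub0set cards0 t1].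
- move=> u ab cd /setU1P[->|abV] /setU1P[->|cdV] //; last exact: Vuniq.
    by case/orP => /eqP /= <-;
      [move/negP: (no0 _ cdV) | move/negP: (unm t (or_intror erefl) _ cdV)].
  by move=> uab /orP[] /eqP /= e; move: uab; rewrite -e;
    [move/negP: (no0 _ abV) | move/negP: (unm t (or_intror erefl) _ abV)].
- move=> u uK us; have [->|u0] := eqVneq u set0.
    by exists (set0, t); rewrite ?setU11 // /touches eqxx.
  have [->|ut] := eqVneq u t; first by exists (set0, t); rewrite ?setU11 // /touches eqxx orbT.
  apply/exists_inP; apply: contraT; rewrite negb_exists_in => /forall_inP h.
  case: (critP u uK u0) => [|e|e]; [left=> ab abV | |]; last 2 first.
    by rewrite e eqxx in us.
    by rewrite e eqxx in ut.
  by apply: h; rewrite inE abV orbT.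
- move=> ab /setU1P[->|]; last exact: (unm s (or_introl erefl)).
  by rewrite /touches /= negb_or eq_sym s0 eq_sym.
- by move=> ab /setU1P[->|//]; rewrite /= eqxx.
- exact: acyc.
by exists s, lo, mu, rho; split=> //; rewrite inE sK sd eqxx.
Qed.

Lemma sphere_morse d K : combinatorial_sphere d K -> morse_sphere d.+1 K.
Proof.
move=> S; have [[K0 cl] [pure two conn] _] := S.
have bnd : bounded d.+1 K.
  move=> s sK; have [t /maxsetP[tK tmax] st] := @maxset_exists _ (mem K) s sK.
  by rewrite -(pure t tK) ?subset_leq_card // => u uK /tmax ->.
have [s0 s0K] := set0Pn _ K0.
split=> //; [exact: cl s0K (sub0set _) | exact: sphere_matching |].
move=> s t sK tK; apply: connect_sub (conn s t sK tK) => {sK tK} a b /= /and3P[aK bK /eqP ab].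
have [aK' /eqP ad] : a \in K /\ #|a| == d.+1 by move: aK; rewrite inE => /andP[].
have [bK' /eqP bd] : b \in K /\ #|b| == d.+1 by move: bK; rewrite inE => /andP[].
apply/connect1/and3P; split; [exact: aK | exact: bK |]; apply/existsP; exists (a :&: b).
rewrite /is_facet subsetIl subsetIr ab ad bd eqxx /=; apply/forall_inP => v vK.
apply/implyP => abv.
have ane : a != b by apply/eqP => e; move: ab; rewrite e setIid bd => /esym /n_Sn.
have := two (a :&: b) (cl _ _ aK' (subsetIl _ _)) ab.
set F := [set _ in _ | _] => F2.
(* Exactly two top simplices contain the intersection of [a] and [b], so there are no others. *)
have : [set a; b] == F.
  rewrite eqEcard F2 cards2 ane andbT; apply/subsetP => u; rewrite !inE.
  by case/orP => /eqP ->; rewrite ?subsetIl ?subsetIr ?aK' ?bK' ?ad ?bd eqxx.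
move/eqP/setP/(_ v); rewrite !inE abv andbT => ->.
by move: vK; rewrite !inE.
Qed.

Lemma morse_dim n K : morse_sphere n K -> complex_dim K = n.-1.
Proof.
case=> _ _ b [s [lo [mu [rho [sK _]]]]] _; congr _.-1; apply/eqP; rewrite eqn_leq.
move: sK; rewrite inE => /andP[sK /eqP sn]; apply/andP; split.
  by apply/bigmax_leqP => t /b.
by rewrite -{1}sn; exact: (@leq_bigmax_cond _ (mem K) (fun s : {set T} => #|s|) s sK).
Qed.

End PairsToMatching.

(** * Joins over disjoint vertex sets *)

Section Join.
Variable T : finType.
Implicit Types (s t u : {set T}) (K : {set {set T}}).

Lemma in_cover K s : s \in K -> s \subset cover K.
Proof. by move=> sK; exact: bigcup_sup. Qed.

Lemma joinP (K1 K2 : {set {set T}}) s :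
  reflect (exists s1 s2, [/\ s1 \in K1, s2 \in K2 & s = s1 :|: s2]) (s \in join K1 K2).
Proof.
apply: (iffP imset2P) => [[s1 s2 h1 h2 ->]|[s1 [s2 [h1 h2 ->]]]]; first by exists s1, s2.
by exists s1 s2.
Qed.

Section TwoComplexes.
Variables K1 K2 : {set {set T}}.
Hypothesis dis : [disjoint cover K1 & cover K2].

Let left s := s :&: cover K1.
Let right s := s :&: cover K2.

Lemma join_left s1 s2 : s1 \in K1 -> s2 \in K2 -> left (s1 :|: s2) = s1.
Proof.
move=> /in_cover h1 /in_cover h2; rewrite /left setIUl (setIidPl h1).
suff -> : s2 :&: cover K1 = set0 by rewrite setU0.
apply/eqP; rewrite setI_eq0 disjoint_sym; exact: disjointWr h2 dis.
Qed.

Lemma join_right s1 s2 : s1 \in K1 -> s2 \in K2 -> right (s1 :|: s2) = s2.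
Proof.
move=> /in_cover h1 /in_cover h2; rewrite /right setIUl (setIidPl h2).
suff -> : s1 :&: cover K2 = set0 by rewrite set0U.
apply/eqP; rewrite setI_eq0; exact: disjointWl h1 dis.
Qed.

Lemma join_inj s1 s2 t1 t2 : s1 \in K1 -> s2 \in K2 -> t1 \in K1 -> t2 \in K2 ->
  s1 :|: s2 = t1 :|: t2 -> s1 = t1 /\ s2 = t2.
Proof.
move=> h1 h2 k1 k2 e; split.
  by rewrite -(join_left h1 h2) e join_left.
by rewrite -(join_right h1 h2) e join_right.
Qed.

Lemma join_eq s1 s2 t1 t2 : s1 \in K1 -> s2 \in K2 -> t1 \in K1 -> t2 \in K2 ->
  (s1 :|: s2 == t1 :|: t2) = (s1 == t1) && (s2 == t2).
Proof.
move=> h1 h2 k1 k2; apply/eqP/andP => [/(join_inj h1 h2 k1 k2)[-> ->]|[/eqP -> /eqP ->]] //.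
Qed.

Lemma join_card s1 s2 : s1 \in K1 -> s2 \in K2 -> #|s1 :|: s2| = (#|s1| + #|s2|)%N.
Proof.
move=> /in_cover h1 /in_cover h2; rewrite cardsU (_ : s1 :&: s2 = set0) ?cards0 ?subn0 //.
apply/eqP; rewrite setI_eq0; exact: disjointWl h1 (disjointWr h2 dis).
Qed.

Lemma join_subset s1 s2 t1 t2 : s1 \in K1 -> s2 \in K2 -> t1 \in K1 -> t2 \in K2 ->
  (s1 :|: s2 \subset t1 :|: t2) = (s1 \subset t1) && (s2 \subset t2).
Proof.
move=> h1 h2 k1 k2; apply/idP/andP => [h|[a b]]; last exact: setUSS.
split; first by rewrite -(join_left h1 h2) -(join_left k1 k2) setSI.
by rewrite -(join_right h1 h2) -(join_right k1 k2) setSI.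
Qed.

Lemma join_facet s1 s2 t1 t2 : s1 \in K1 -> s2 \in K2 -> t1 \in K1 -> t2 \in K2 ->
  is_facet (s1 :|: s2) (t1 :|: t2) =
  (s1 == t1) && is_facet s2 t2 || is_facet s1 t1 && (s2 == t2).
Proof.
move=> h1 h2 k1 k2; rewrite /is_facet join_subset // !join_card //.
apply/idP/idP => [/andP[/andP[a b] /eqP e]|].
  have la := subset_leq_card a; have lb := subset_leq_card b.
  rewrite a b !eqEcard a b /=.
  lia.
case/orP => [/and3P[/eqP -> -> /eqP ->]|/andP[/andP[-> /eqP ->] /eqP ->]].
  by rewrite subxx addnS eqxx.
by rewrite subxx addSn eqxx.
Qed.

Lemma join_closed : closed_sub K1 -> closed_sub K2 -> closed_sub (join K1 K2).
Proof.
move=> c1 c2 s t /joinP[s1 [s2 [h1 h2 ->]]] ts; apply/joinP.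
exists (t :&: s1), (t :&: s2); split.
- by apply: c1 h1 _; exact: subsetIr.
- by apply: c2 h2 _; exact: subsetIr.
- by rewrite -setIUr; apply/esym/setIidPl.
Qed.

Lemma join_layer n1 n2 s1 s2 : bounded n1 K1 -> bounded n2 K2 ->
  s1 \in K1 -> s2 \in K2 -> (s1 :|: s2 \in layer (join K1 K2) (n1 + n2)) =
  (s1 \in layer K1 n1) && (s2 \in layer K2 n2).
Proof.
move=> b1 b2 h1 h2; rewrite !inE h1 h2 /= join_card //.
rewrite (_ : _ :|: _ \in _ = true) /=; last by apply/joinP; exists s1, s2.
have := b1 _ h1; have := b2 _ h2; lia.
Qed.

(* The pairs of the second matching are used while the second component is not
   the critical simplex s2, and those of the first matching otherwise; the
   former get smaller ranks, since s2, being of top dimension, is not a facet. *)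
Lemma join_matching n2 s1 lo1 mu1 rho1 s2 lo2 mu2 rho2 : bounded n2 K2 ->
  s1 \in K1 -> s2 \in layer K2 n2 ->
  matching (K1 :\ s1) lo1 mu1 rho1 -> matching (K2 :\ s2) lo2 mu2 rho2 ->
  exists lo mu rho, matching (join K1 K2 :\ (s1 :|: s2)) lo mu rho.
Proof.
move=> b2 s1K; rewrite inE => /andP[s2K /eqP s2n] [in1 K_1 l1 f1 r1] [in2 K_2 l2 f2 r2].
pose lo s := if right s == s2 then lo1 (left s) else lo2 (right s).
pose mu s := if right s == s2 then mu1 (left s) :|: s2 else left s :|: mu2 (right s).
pose rho s := if right s == s2 then ((\max_t rho2 t).+1 + rho1 (left s))%N else rho2 (right s).
pose L1 := K1 :\ s1; pose L2 := K2 :\ s2.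
have LP s : s \in join K1 K2 :\ (s1 :|: s2) ->
    (exists2 t1, t1 \in L1 & s = t1 :|: s2) \/
    (exists t1 t2, [/\ t1 \in K1, t2 \in L2 & s = t1 :|: t2]).
  rewrite inE in_set1 => /andP[ne /joinP[t1 [t2 [h1 h2 e]]]].
  move: ne; rewrite e join_eq // negb_and.
  have [e2|ne2 _] := eqVneq t2 s2; last by right; exists t1, t2; rewrite !inE ne2 h2.
  by rewrite orbF => ne1; left; exists t1; rewrite ?e2 // !inE ne1.
have L1K t : t \in L1 -> t \in K1 by rewrite inE => /andP[].
have L2K t : t \in L2 -> t \in K2 by rewrite inE => /andP[].
have L2n t : t \in L2 -> (t == s2) = false by rewrite !inE => /andP[/negbTE].
have L1n t : t \in L1 -> (t == s1) = false by rewrite !inE => /andP[/negbTE].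
have lo_1 t1 : t1 \in L1 -> lo (t1 :|: s2) = lo1 t1.
  by move=> /L1K h; rewrite /lo join_right // join_left // eqxx.
have lo_2 t1 t2 : t1 \in K1 -> t2 \in L2 -> lo (t1 :|: t2) = lo2 t2.
  by move=> h k; rewrite /lo join_right // ?L2K // L2n.
have mu_1 t1 : t1 \in L1 -> mu (t1 :|: s2) = mu1 t1 :|: s2.
  by move=> /L1K h; rewrite /mu join_right // join_left // eqxx.
have mu_2 t1 t2 : t1 \in K1 -> t2 \in L2 -> mu (t1 :|: t2) = t1 :|: mu2 t2.
  by move=> h k; rewrite /mu join_right // ?join_left // ?L2K // L2n.
have in_1 t1 : t1 \in L1 -> t1 :|: s2 \in join K1 K2 :\ (s1 :|: s2).
  move=> h; rewrite inE in_set1 join_eq // ?L1K // L1n //=.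
  by apply/joinP; exists t1, s2; rewrite L1K.
have in_2 t1 t2 : t1 \in K1 -> t2 \in L2 -> t1 :|: t2 \in join K1 K2 :\ (s1 :|: s2).
  move=> h k; rewrite inE in_set1 join_eq // ?L2K // L2n // andbF /=.
  by apply/joinP; exists t1, t2; rewrite L2K.
exists lo, mu, rho; split.
- move=> s /LP[[t1 h ->]|[t1 [t2 [h k ->]]]]; rewrite ?mu_1 ?mu_2 //.
    by apply: in_1; exact: in1.
  by apply: in_2 => //; exact: in2.
- move=> s /LP[[t1 h ->]|[t1 [t2 [h k ->]]]].
    by rewrite !mu_1 ?K_1 //; exact: in1.
  by rewrite !mu_2 ?K_2 //; exact: in2.
- move=> s /LP[[t1 h ->]|[t1 [t2 [h k ->]]]].
    by rewrite mu_1 // !lo_1 ?l1 //; exact: in1.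
  by rewrite mu_2 // !lo_2 ?l2 //; exact: in2.
- move=> s /LP[[t1 h ->]|[t1 [t2 [h k ->]]]].
    rewrite mu_1 // lo_1 // => /(f1 _ h) f.
    by rewrite join_facet // ?L1K ?f ?eqxx ?orbT //; exact: in1.
  rewrite mu_2 // lo_2 // => /(f2 _ k) f.
  by rewrite join_facet // ?L2K ?f ?eqxx //; exact: in2.
have nofacet t : t \in K2 -> ~~ is_facet s2 t.
  by move=> /b2 tb; apply/negP => /andP[_ /eqP e]; move: tb; rewrite e s2n ltnn.
move=> s t /LP[[u1 h ->]|[u1 [u2 [h k ->]]]] /LP[[v1 h' ->]|[v1 [v2 [h' k' ->]]]];
  rewrite ?mu_1 ?mu_2 ?lo_1 ?lo_2 // => los lot.
- rewrite join_facet // ?L1K //; last exact: in1.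
  rewrite (negbTE (nofacet _ s2K)) andbF /= eqxx andbT join_eq // ?L1K // eqxx andbT => f ne.
  rewrite /rho !join_right // ?join_left // ?L1K // eqxx ltn_add2l.
  exact: r1.
- move=> _ _; rewrite /rho !join_right // ?join_left // ?L1K ?L2K // eqxx L2n //.
  by rewrite addSn ltnS (leq_trans (leq_bigmax v2)) ?leq_addr.
(* A step from the second kind of pair to the first would need [s2] as second component, but [s2] is
   neither a facet nor a value of [mu2] on [L2]. *)
- rewrite join_facet // ?L1K ?L2K ?in2 // (negbTE (nofacet _ _)) ?L2K ?in2 // andbF /=.
  by case/andP=> _ /eqP e; have := in2 _ k; rewrite -e !inE eqxx.
(* If the first component shrinks, the second is the upper simplex [mu2 u2], so the result is not a
   lower simplex. Hence only the second component moves. *)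
rewrite join_facet // ?L2K ?in2 // join_eq // ?L2K // => /orP[/andP[/eqP e f]|/andP[_ /eqP e]].
  rewrite e eqxx /= => ne; rewrite /rho !join_right // ?L2K // !L2n //.
  by apply: r2.
by move: lot; rewrite e l2 // los.
Qed.

Lemma connect_homo (A B : finType) (e : rel A) (e' : rel B) (g : A -> B) x y :
  (forall a b, e a b -> e' (g a) (g b)) -> connect e x y -> connect e' (g x) (g y).
Proof.
move=> h /connectP[p pth ->]; elim: p x pth => [|z p IH] x /=; first by rewrite connect0.
by case/andP => /h/connect1 c /IH; apply: connect_trans.
Qed.

Lemma morse_join n1 n2 : morse_sphere n1 K1 -> morse_sphere n2 K2 ->
  morse_sphere (n1 + n2) (join K1 K2).
Proof.
case=> c1 e1 b1 [s1 [lo1 [mu1 [rho1 [s1K M1]]]]] k1.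
case=> c2 e2 b2 [s2 [lo2 [mu2 [rho2 [s2K M2]]]]] k2.
have LK1 s : s \in layer K1 n1 -> s \in K1 by rewrite inE => /andP[].
have LK2 s : s \in layer K2 n2 -> s \in K2 by rewrite inE => /andP[].
split.
- exact: join_closed.
- by apply/joinP; exists set0, set0; rewrite setU0.
- move=> s /joinP[t1 [t2 [/[dup] h1 /b1 l1 /[dup] h2 /b2 l2 ->]]].
  by rewrite join_card // leq_add.
- have [lo [mu [rho M]]] := join_matching b2 (LK1 _ s1K) s2K M1 M2.
  exists (s1 :|: s2), lo, mu, rho; split=> //.
  by rewrite join_layer // ?LK1 ?LK2 ?s1K.
move=> s t sK tK.
have split u : u \in layer (join K1 K2) (n1 + n2) ->
    exists u1 u2, [/\ u1 \in layer K1 n1, u2 \in layer K2 n2 & u = u1 :|: u2].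
  move=> uK; move: (uK); rewrite inE => /andP[/joinP[u1 [u2 [h1 h2 e]]] _].
  by exists u1, u2; move: uK; rewrite e join_layer // => /andP[-> ->].
move: s1 s2 s1K s2K M1 M2 => _ _ _ _ _ _.
have [s1 [s2 [s1K s2K ->]]] := split _ sK.
have [t1 [t2 [t1K t2K ->]]] := split _ tK.
(* The components are moved one after the other. Top simplices of the idle factor containing one
   another are equal, so the shared facet lies in no further top simplex. *)
apply: (@connect_trans _ _ (t1 :|: s2)).
  apply: (connect_homo (g := fun u => u :|: s2)) (k1 _ _ s1K t1K) => a b.
  case/and3P => aK bK /existsP[u /and3P[ua ub /forall_inP h]].
  have uK : u \in K1 by case/andP: ua => /c1 -> //; exact: LK1.
  apply/and3P; split; rewrite ?join_layer // ?aK ?bK ?s2K // ?LK1 ?LK2 //.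
  apply/existsP; exists (u :|: s2).
  rewrite !join_facet // ?LK1 ?LK2 // ua ub eqxx !orbT /=.
  apply/forall_inP => v /split[v1 [v2 [v1K v2K ->]]]; apply/implyP.
  rewrite join_subset // ?LK1 ?LK2 // => /andP[uv sv].
  have -> : v2 = s2.
    move: v2K s2K; rewrite !inE => /andP[_ /eqP a2] /andP[_ /eqP a3].
    by apply/esym/eqP; rewrite eqEcard sv a2 a3 leqnn.
  by rewrite !join_eq // ?LK1 ?LK2 // eqxx !andbT; have := h _ v1K; rewrite uv.
apply: (connect_homo (g := fun u => t1 :|: u)) (k2 _ _ s2K t2K) => a b.
case/and3P => aK bK /existsP[u /and3P[ua ub /forall_inP h]].
have uK : u \in K2 by case/andP: ua => /c2 -> //; exact: LK2.
apply/and3P; split; rewrite ?join_layer // ?aK ?bK ?t1K // ?LK1 ?LK2 //.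
apply/existsP; exists (t1 :|: u).
rewrite !join_facet // ?LK1 ?LK2 // ua ub eqxx /=.
apply/forall_inP => v /split[v1 [v2 [v1K v2K ->]]]; apply/implyP.
rewrite join_subset // ?LK1 ?LK2 // => /andP[sv uv].
have -> : v1 = t1.
  move: v1K t1K; rewrite !inE => /andP[_ /eqP a2] /andP[_ /eqP a3].
  by apply/esym/eqP; rewrite eqEcard sv a2 a3 leqnn.
by rewrite !join_eq // ?LK1 ?LK2 // eqxx /=; have := h _ v2K; rewrite uv.
Qed.

End TwoComplexes.
End Join.

(** * The diagonal action *)

Section IteratedJoin.
Variables (p m : nat) (T : finType).
Variables (S : 'I_m -> {set {set T}}) (to : 'I_m -> {action 'Z_p &-> T}).
Hypothesis p_prime : prime p.
Hypothesis S_sphere : forall i, Zp_combinatorial_sphere (S i) (to i).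
Hypothesis S_disjoint : forall i j, i != j -> [disjoint cover (S i) & cover (S j)].

Let J (r : seq 'I_m) : {set {set T}} := \big[@join T/[set set0]]_(i <- r) S i.

Lemma cover_join_seq r s x : s \in J r -> x \in s -> exists2 i, i \in r & x \in cover (S i).
Proof.
rewrite /J; elim: r s => [|i r IH] s; first by rewrite big_nil inE => /eqP ->; rewrite inE.
rewrite big_cons => /joinP[s1 [s2 [h1 h2 ->]]]; rewrite inE => /orP[xs|/(IH _ h2)[j jr xj]].
  by exists i; rewrite ?mem_head // (subsetP (in_cover h1)).
by exists j; rewrite // in_cons jr orbT.
Qed.

Lemma disjoint_join_seq i r : i \notin r -> [disjoint cover (S i) & cover (J r)].
Proof.
move=> ir; rewrite -setI_eq0; apply/eqP/setP => x; rewrite !inE.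
apply/negP => /andP[xi /bigcupP[s sJ xs]]; have [j jr xj] := cover_join_seq sJ xs.
have ij : i != j by apply: contraNneq ir => ->.
by have /pred0P/(_ x) := S_disjoint ij; rewrite /= xi xj.
Qed.

(** The empty join {∅} is the case [n = 0], with ∅ as critical simplex. The bound on [n] makes it
    positive for a nonempty family. *)
Lemma morse_join_seq r : uniq r -> exists2 n, morse_sphere n (J r) & (size r <= n)%N.
Proof.
rewrite /J; elim: r => [_|i r IH /= /andP[ir /IH[n M nr]]].
  exists 0%N; rewrite ?big_nil //; split.
  - by move=> s t; rewrite !inE => /eqP ->; rewrite subset0.
  - by rewrite inE.
  - by move=> s; rewrite inE => /eqP ->; rewrite cards0.
  - exists set0, (fun=> true), id, (fun=> 0%N); split; first by rewrite !inE cards0 eqxx.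
    by split=> s; rewrite ?setDv ?inE // => ?; rewrite setDv inE.
  by move=> s t; rewrite !inE => /andP[/eqP -> _] /andP[/eqP -> _]; exact: connect0.
have [[d /sphere_morse Si] _ _] := S_sphere i.
exists (d.+1 + n)%N; last by rewrite addSn ltnS (leq_trans nr) ?leq_addl.
rewrite big_cons; apply: morse_join => //; exact: disjoint_join_seq.
Qed.

Lemma diag_act_in i x g : x \in cover (S i) -> diag_act S to g x = to i x g.
Proof.
rewrite /diag_act => xi; case: pickP => [j xj|/(_ i)]; last by rewrite xi.
have [->//|ij] := eqVneq i j.
by have /pred0P/(_ x) := S_disjoint ij; rewrite /= xi xj.
Qed.

Lemma sphere_act i s g : s \in S i -> to i ^~ g @: s \in S i.
Proof.
have [_ act _] := S_sphere i => sS; have := acts_act act (in_setT g) s.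
by rewrite /= sS.
Qed.

Lemma act_cover i x g : x \in cover (S i) -> to i x g \in cover (S i).
Proof.
case/bigcupP => s sS xs; apply/bigcupP; exists (to i ^~ g @: s); first exact: sphere_act.
exact: (imset_f (to i ^~ g)).
Qed.

Lemma diag_act1 x : diag_act S to 1%g x = x.
Proof. by rewrite /diag_act; case: pickP => // i _; exact: act1. Qed.

Lemma diag_actM x g h : diag_act S to (g * h)%g x = diag_act S to h (diag_act S to g x).
Proof.
have [/existsP[i xi]|/existsPn no] := boolP [exists i, x \in cover (S i)].
  by rewrite !(diag_act_in _ xi) (diag_act_in _ (act_cover _ xi)) actM.
have e k : diag_act S to k x = x.
  by rewrite /diag_act; case: pickP => // i xi; have := no i; rewrite xi.
by rewrite !e.
Qed.

Definition diag_action : {action 'Z_p &-> T} :=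
  TotalAction (to := fun x g => diag_act S to g x) diag_act1 diag_actM.

Lemma diag_inj g : injective (diag_act S to g).
Proof. exact: (act_inj diag_action). Qed.

Lemma diag_join_seq r s g : s \in J r -> diag_act S to g @: s \in J r.
Proof.
rewrite /J; elim: r s => [|i r IH] s.
  by rewrite big_nil !inE => /eqP ->; rewrite imset0.
rewrite big_cons => /joinP[s1 [s2 [h1 h2 ->]]]; apply/joinP.
exists (diag_act S to g @: s1), (diag_act S to g @: s2); split; last exact: imsetU.
  rewrite (_ : _ @: s1 = to i ^~ g @: s1); first exact: sphere_act.
  by apply: eq_in_imset => x /(subsetP (in_cover h1))/diag_act_in.
exact: IH.
Qed.

(** The action preserves each factor, so the components of a fixed simplex are fixed separately, and
    each is empty. *)
Lemma diag_free r s g : uniq r -> s \in J r -> g != 1%g -> diag_act S to g @: s = s -> s = set0.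
Proof.
move=> ur sJ g1; elim: r s ur sJ => [|i r IH] s /=; first by rewrite /J big_nil inE => _ /eqP.
case/andP => ir ur; rewrite /J big_cons -/(J r) => /joinP[s1 [s2 [h1 h2 ->]]] e.
have dis := disjoint_join_seq ir.
have a1 : diag_act S to g @: s1 \in S i.
  rewrite (_ : _ @: s1 = to i ^~ g @: s1); first exact: sphere_act.
  by apply: eq_in_imset => x /(subsetP (in_cover h1))/diag_act_in.
have a2 := diag_join_seq g h2.
move: e; rewrite imsetU => /(join_inj dis a1 a2 h1 h2)[e1 e2].
rewrite (IH _ ur h2 e2) setU0; apply/eqP/contraT => s0.
have [_ _ free] := S_sphere i; have := free g s1 g1 h1 s0; case/eqP.
by rewrite -[RHS]e1 /=; apply: eq_in_imset => x /(subsetP (in_cover h1))/diag_act_in ->.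
Qed.

Local Notation K := (iterated_join S).

(** Stabilisers of nonempty simplices are trivial, so every orbit has [p] elements and contributes a
    multiple of [p]. *)
Lemma free_sum (F : {set T} -> int) :
  (forall g s, s \in K -> F (diag_act S to g @: s) = F s) ->
  (p %| \sum_(s in K :\ set0) F s)%Z.
Proof.
move=> FG; pose A := diag_action^*%act.
have AE s g : A s g = diag_act S to g @: s by [].
have acts : [acts [set: 'Z_p], on K :\ set0 | A].
  apply/subsetP => g _; rewrite inE; apply/andP; split; first by rewrite inE.
  rewrite inE; apply/subsetP => s; rewrite !inE => /andP[s0 sK].
  rewrite AE -card_gt0 card_imset ?card_gt0 ?s0; last exact: diag_inj.
  exact: diag_join_seq.
have part := orbit_partition acts.
rewrite (set_partition_big _ part) /=; apply: rpred_sum => _ /imsetP[s sK ->].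
move: sK; rewrite !inE => /andP[s0 sK].
rewrite (eq_bigr (fun=> F s)) => [|_ /imsetP[g _ ->]]; last exact: FG.
rewrite sumr_const card_orbit (_ : 'C_[set: 'Z_p][s | A]%g = 1%g).
  rewrite indexg1 cardsT card_ord Zp_cast ?prime_gt1 // -mulr_natr natz.
  exact: dvdz_mull.
apply/setP => g; rewrite !inE sub1set inE AE andTb.
apply/eqP/eqP => [e|->].
  apply: contraNeq s0 => g1; apply/eqP; apply: (diag_free (r := index_enum _) _ sK g1 e).
  exact: index_enum_uniq.
by rewrite -AE act1.
Qed.

Lemma supertrace_mod (le : rel T) (F : {additive chain T -> chain T}) : total_order le ->
  set0 \in K -> F (basis set0) = basis set0 ->
  (forall g s, s \in K -> F (simplicial_chain_map le le (diag_act S to g) (basis s)) =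
     simplicial_chain_map le le (diag_act S to g) (F (basis s))) ->
  (p %| \sum_(s in K) (-1) ^+ #|s| * F (basis s) s - 1)%Z.
Proof.
move=> tot K0 F0 FG; rewrite (big_setD1 _ K0) /= cards0 F0 basisE eqxx.
rewrite expr0 mul1r addrAC subrr add0r; apply: free_sum => g s sK.
have inj := @diag_inj g; rewrite card_imset //; congr (_ * _).
have [|e ee es] := @smap_inj _ _ le le tot (diag_act S to g) s; first by move=> ? ? _ _ /inj.
(* The sign [e] of the action on [s] appears on both sides and cancels, so diagonal coefficients are
   constant on orbits. *)
have /ffunP/(_ (diag_act S to g @: s)) := FG g s sK.
rewrite (smap_coef _ tot _ _ inj) es raddfMz !ffunMzE basisE eqxx mul1r => h.
by rewrite -[LHS]mulr1 -ee mulrA h -mulrA ee mulr1.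
Qed.

End IteratedJoin.

(** * Iterated subdivision and the degree *)

Section IteratedSubdivision.
Variable T : finType.
Variable ord : forall j : nat, rel (bdT T j).
Hypothesis ord_total : forall j, total_order (@ord j).
Implicit Types (c : chain T) (K : {set {set T}}).

Fixpoint subk (k : nat) (c : chain T) : chain (bdT T k) :=
  match k return chain (bdT T k) with
  | 0 => c
  | k'.+1 => sub (@ord k') (@ord k'.+1) (subk k' c)
  end.

Lemma subk_is_zmod_morphism k : zmod_morphism (subk k).
Proof. by elim: k => //= k IH c c'; rewrite IH raddfB. Qed.
HB.instance Definition _ k :=
  GRing.isZmodMorphism.Build (chain T) (chain (bdT T k)) (subk k) (subk_is_zmod_morphism k).

Lemma Bdk_closed k K : closed_sub K -> closed_sub (Bdk k K).
Proof. by case: k => // k _; exact: Bd_closed. Qed.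

Lemma Bdk_bounded n k K : bounded n K -> bounded n (Bdk k K).
Proof. by elim: k => //= k IH /IH; exact: Bd_bounded. Qed.

Lemma subk_set0 k : subk k (basis set0) = basis set0.
Proof. by elim: k => //= k ->; rewrite sub_set0. Qed.

Lemma subk_bdry k c : bdry (@ord k) (subk k c) = subk k (bdry (@ord 0) c).
Proof. by elim: k => //= k IH; rewrite (sub_bdry (ord_total k) (ord_total k.+1)) IH. Qed.

Lemma subk_on k K n c : closed_sub K -> on (layer K n) c -> on (layer (Bdk k K) n) (subk k c).
Proof.
move=> cl onc; elim: k => //= k IH; apply: sub_on => //; exact: Bdk_closed.
Qed.

Lemma subk_unit n k K c : closed_sub K -> bounded n K -> (0 < n)%N ->
  on (layer K n) c -> (forall s, s \in layer K n -> c s * c s = 1) ->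
  forall d, d \in layer (Bdk k K) n -> subk k c d * subk k c d = 1.
Proof.
move=> cl b n0 onc c1; elim: k => //= k IH d.
by apply: sub_unit => //; [exact: Bdk_bounded | exact: subk_on].
Qed.

Lemma sub_ord_inj (x0 : T) k (c : chain (bdT T k)) :
  sub (@ord k) (@ord k.+1) c = 0 -> c = 0.
Proof.
apply: (sub_inj (ord_total k) (ord_total k.+1)).
by case: (k) => [|k']; [exact: x0 | exact: set0].
Qed.

Lemma subk_inj (x0 : T) k c : subk k c = 0 -> c = 0.
Proof. by elim: k => //= k IH /(sub_ord_inj x0). Qed.

Lemma sdkE q k K c : closed_sub K -> on (layer K q.+1) c -> sdk ord k q c = subk k c.
Proof.
move=> cl onc; elim: k => //= k ->.
by rewrite (sdE (ord_total k) (ord_total k.+1) (subk_on (k := k) cl onc)).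
Qed.

(** Subdivisions are undone one at a time; injectivity of [sub] passes the cycle condition down to
    the previous level. *)
Lemma subk_surj (x0 : T) n k K (c : chain (bdT T k)) : bounded n.+1 K ->
  on (layer (Bdk k K) n.+1) c -> (n != 0 -> bdry (@ord k) c = 0) ->
  exists2 c', on (layer K n.+1) c' & c = subk k c'.
Proof.
move=> b; elim: k c => [|k IH] c onc cyc; first by exists c.
have [c1 onc1 e] := sub_surj (ord_total k) (ord_total k.+1) (Bdk_bounded (k := k) b) onc cyc.
have [n0|c2 onc2 e2] := IH c1 onc1; last by exists c2; rewrite // e e2.
by apply: (sub_ord_inj x0); rewrite -(sub_bdry (ord_total k) (ord_total k.+1)) -e cyc.
Qed.

Lemma bd_map_inj k (h : T -> T) : injective h -> injective (@bd_map T k h).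
Proof. by move=> inj; elim: k => //= k IH; exact: imset_inj. Qed.

Lemma subk_natural k (h : T -> T) c : injective h ->
  simplicial_chain_map (@ord k) (@ord k) (bd_map h) (subk k c) =
  subk k (simplicial_chain_map (@ord 0) (@ord 0) h c).
Proof.
move=> inj; elim: k => //= k <-.
have tk := ord_total k; have tk1 := ord_total k.+1.
by rewrite -(sub_natural tk tk1 tk tk1 (bd_map_inj inj)).
Qed.

End IteratedSubdivision.

(** * The degree modulo p *)

Theorem theorem1p9 (p k m : nat) (T : finType)
    (S : 'I_m -> {set {set T}}) (to : 'I_m -> {action 'Z_p &-> T})
    (ord : forall j : nat, rel (bdT T j)) (f : bdT T k -> T)
    (p_prime : prime p) (m_gt0 : (0 < m)%N)
    (S_sphere : forall i, Zp_combinatorial_sphere (S i) (to i))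
    (S_disjoint : forall i j, i != j ->
       [disjoint cover (S i) & cover (S j)])
    (ord_total : forall j, total_order (ord j))
    (f_simplicial : simplicial (Bdk k (iterated_join S)) (iterated_join S) f)
    (f_equivariant : equivariant S to f) :
  (exists deg : int, is_degree ord (iterated_join S) f deg) /\
  (forall deg : int, is_degree ord (iterated_join S) f deg ->
     (deg = 1 %[mod p])%Z).
Proof.
have tot j : total_order (@ord j) := ord_total j.
set K := iterated_join S in f_simplicial f_equivariant *.
have [n M n0] : exists2 n, morse_sphere n K & (0 < n)%N.
  have [n M mn] := morse_join_seq S_sphere S_disjoint (index_enum_uniq _).
  exists n => //; apply: leq_trans mn; case: (m) m_gt0 => // m' _.
  by rewrite lt0n size_eq0; apply/eqP => e; have := mem_index_enum (ord0 : 'I_m'.+1); rewrite e.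
(* From here on [n] is the dimension of [K], and top simplices have [n.+1] vertices. *)
case: n => // n in M n0 *.
have dimK : complex_dim K = n by rewrite (morse_dim M).
have [z [onz cycz unitz hom]] := fundamental_cycle (tot 0%N) n0 M.
have [cl K0 b [sigma [_ [_ [_ [sK _]]]]] _] := M.
have z0 : z != 0.
  by apply/eqP => e; have := unitz _ sK; rewrite e ffunE mul0r.
have /set0Pn[x0 _] : sigma != set0.
  by rewrite -card_gt0; move: sK; rewrite inE => /andP[_ /eqP ->].
pose fc := simplicial_chain_map (@ord k) (@ord 0) f.
pose F : {additive chain T -> chain T} := fc \o subk ord k.
have fc_on q c : on (layer (Bdk k K) q) c -> on (layer K q) (fc c).
  exact: (smap_on (@ord k) (tot 0%N) f_simplicial).
have F_on q c : on (layer K q) c -> on (layer K q) (F c).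
  by move=> onc; apply: fc_on; apply: subk_on.
have F_bdry c : F (bdry (@ord 0) c) = bdry (@ord 0) (F c).
  by rewrite /F /= -(subk_bdry tot) /fc (smap_bdry (tot k) (tot 0%N)).
have F_set0 : F (basis set0) = basis set0.
  by rewrite /F /= subk_set0 /fc (smap_set0 _ (tot 0%N)).
have top_cycle c : on (layer K n.+1) c -> bdry (@ord 0) c = 0 -> exists a : int, c = z *~ a.
  move=> onc cyc; have [w [a [onw -> _]]] := hom _ _ onc cyc; exists a.
  suff -> : w = 0 by rewrite raddf0 add0r.
  apply/ffunP => t; rewrite ffunE; apply: onw; rewrite inE.
  by apply/negP => /andP[/b tb /eqP te]; rewrite te ltnn in tb.
have Mz_inj (a a' : int) : z *~ a = z *~ a' -> a = a'.
  move=> /ffunP/(_ sigma); rewrite !ffunMzE => /(congr1 ( *%R (z sigma))).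
  by rewrite !mulrA unitz // !mul1r.
have [d Fz] : exists d : int, F z = z *~ d.
  by apply: top_cycle; [exact: F_on | rewrite -F_bdry cycz raddf0].
have d1 : (p %| d - 1)%Z.
  (* Equivariance on simplices, read on singletons, gives equivariance on the vertices of the
     subdivision, which is what the chain maps see. *)
  have f_eq g x : [set x] \in Bdk k K -> f (bd_map (diag_act S to g) x) = diag_act S to g (f x).
    by move=> /(f_equivariant g); rewrite !imset_set1 => /set1_inj.
  have F_equiv g s : s \in K ->
      F (simplicial_chain_map (@ord 0) (@ord 0) (diag_act S to g) (basis s)) =
      simplicial_chain_map (@ord 0) (@ord 0) (diag_act S to g) (F (basis s)).
    move=> sK'; rewrite /F /= -(subk_natural tot); last exact: diag_inj.
    rewrite /fc (smap_comp _ _ _ (tot k) (tot k) (tot 0%N)).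
    rewrite (smap_comp _ _ _ (tot k) (tot 0%N) (tot 0%N)).
    have on_sub : on (layer (Bdk k K) #|s|) (subk ord k (basis s)).
      by apply: subk_on => //; apply: on_basis; rewrite inE sK' eqxx.
    apply: additive_ext_on on_sub => c; rewrite inE => /andP[cB _].
    apply: (smap_eq _ (tot 0%N)) => x xc /=.
    by apply: f_eq; apply: (Bdk_closed cl) cB _; rewrite sub1set.
  have := supertrace (tot 0%N) cl b onz cycz z0 hom F_bdry F_on Fz.
  have := supertrace_mod p_prime S_sphere S_disjoint (tot 0%N) K0 _ F_equiv.
  have := supertrace (F := idfun) (m := 1) (tot 0%N) cl b onz cycz z0 hom.
  have := supertrace_mod (F := idfun) p_prime S_sphere S_disjoint (tot 0%N) K0.
  rewrite mulr1z => h1 h2 h3 h4.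
  have e1 : (p %| (-1) ^+ n.+1 - 1)%Z.
    by have := h1 erefl (fun _ _ _ => erefl); rewrite h2 // mulr1.
  have e2 : (p %| (-1) ^+ n.+1 * d - 1)%Z by rewrite -h4; exact: h3 F_set0.
  rewrite (_ : d - 1 = ((-1) ^+ n.+1 * d - 1) - d * ((-1) ^+ n.+1 - 1)); last by ring.
  by rewrite rpredB // dvdz_mull.
have sub_z_on := subk_on tot (k := k) cl onz.
have deg_eq (xi : {set bdT T k} -> int) c : on (layer K n.+1) c ->
    fundamental_chain (Bdk k K) n xi = subk ord k c ->
    sdk ord k n (fc (fundamental_chain (Bdk k K) n xi)) = subk ord k (F c).
  move=> onc ->; exact: (sdkE tot k cl (F_on _ _ onc)).
split.
  (* The coefficients of the subdivided fundamental cycle serve as orientation. *)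
  exists d; exists (subk ord k z); rewrite dimK.
  have e : fundamental_chain (Bdk k K) n (subk ord k z) = subk ord k z.
    by rewrite [RHS](onE sub_z_on).
  split; last by apply: (etrans (deg_eq _ z onz e)); rewrite Fz raddfMz e.
  split.
    move=> s sB; have := subk_unit tot cl b n0 onz unitz sB.
    move/eqP; rewrite -expr2 sqrf_eq1 => /orP[] /eqP ->; auto.
  rewrite e; case: (n) => // n'; rewrite boundaryE // subk_bdry // cycz; exact: raddf0.
move=> deg [xi]; rewrite dimK => -[[unitxi cycxi] edeg].
suff : (p %| deg - 1)%Z by rewrite -eqz_mod_dvd => /eqP.
set z' := fundamental_chain _ _ _ in cycxi edeg.
have onz' : on (layer (Bdk k K) n.+1) z'.
  by apply: on_sum => s sB; apply: onMz; apply: on_basis.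
(* For an arbitrary orientation, its chain is the subdivision of some [c], and injectivity of [subk]
   turns the degree equation into [F c = c *~ deg]. *)
have [cyc'|c onc e] := subk_surj tot x0 b onz'.
  by case: (n) cyc' cycxi => // n' _; rewrite boundaryE.
have c0 : c != 0.
  have [s sB] : exists s, s \in layer (Bdk k K) n.+1.
    apply/existsP; apply: contraNT z0 => /existsPn no; apply/eqP/(subk_inj tot x0 (k := k)).
    by apply/ffunP => s; rewrite ffunE sub_z_on.
  apply/eqP => c0; have : z' s = 0 by rewrite e c0 raddf0 ffunE.
  rewrite /z' /fundamental_chain sum_ffunE (bigD1 s) //= big1 => [|t /andP[_ ts]].
    by rewrite addr0 ffunMzE basisE eqxx mul1r; case: (unitxi s sB) => ->.
  by rewrite ffunMzE basisE eq_sym (negbTE ts) mul0r.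
have Fc : F c = c *~ deg.
  apply/eqP; rewrite -subr_eq0; apply/eqP/(subk_inj tot x0 (k := k)).
  by rewrite raddfB raddfMz /= -[_ (F c)](deg_eq xi c) // edeg -/z' e subrr.
(* If [c] is a reduced cycle, it is a nonzero multiple of [z], whence [deg = d]. *)
have [cyc|ncyc] := eqVneq (bdry (@ord 0) c) 0.
  have [a e'] := top_cycle c onc cyc; rewrite e' raddfMz Fz !mulrzM in Fc.
  have /eqP := Mz_inj _ _ Fc; rewrite [d * a]mulrC => /eqP/mulfI <- //.
  by apply: contraNneq c0 => a0; rewrite e' a0 mulr0z.
(* Otherwise the dimension is 0 and [c] has nonzero augmentation; [F] fixes the empty simplex and
   commutes with [bdry], so [deg = 1]. *)
have n_eq0 : n = 0%N.
  apply/eqP; apply: contraNT ncyc => nn; apply/eqP/(subk_inj tot x0 (k := k)).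
  rewrite -(subk_bdry tot) -e; case: (n) nn cycxi => // n' _.
  by rewrite boundaryE.
have /on1E ec : on [set set0] (bdry (@ord 0) c).
  apply: onS (bdry_on (tot 0%N) cl onc); apply/subsetP => s.
  by rewrite n_eq0 !inE => /andP[_]; rewrite cards_eq0.
have : bdry (@ord 0) c = bdry (@ord 0) c *~ deg.
  have <- : bdry (@ord 0) (F c) = bdry (@ord 0) c *~ deg by rewrite Fc raddfMz.
  by rewrite -F_bdry {2}ec raddfMz F_set0.
move/ffunP/(_ set0); rewrite ffunMzE -{1}[bdry _ _ _]mulr1 => /mulfI <-.
  by rewrite subrr dvdz0.
by apply: contraNneq ncyc => a0; rewrite ec a0 mulr0z.
Qed.
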